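(* Let $G_m$ be a bounded Vilenkin group. There is a constant $c<\infty$ (depending only on $m$) such that for every martingale $f\in H_{1/2}(G_m)$, $$\Big\|\sup_{n\in P_+}\frac{|\sigma_n f|}{\log^2(n+1)}\Big\|_{L_{1/2}(G_m)}\le c\,\|f\|_{H_{1/2}(G_m)} .$$ That is, the maximal operator $\widetilde\sigma^*f:=\sup_{n\in P_+}\frac{|\sigma_nf|}{\log^2(n+1)}$ is bounded from $H_{1/2}(G_m)$ to $L_{1/2}(G_m)$.
   Context: Let $P_+$ be the positive integers and $P=P_+\cup\{0\}$. Let $m=(m_0,m_1,\dots)$ be a sequence of integers $m_k\ge 2$ with $\sup_k m_k<\infty$ (bounded Vilenkin group). $G_m$ is the complete direct product of the cyclic groups $Z_{m_k}=\{0,1,\dots,m_k-1\}$ (addition mod $m_k$), with product of discrete topologies and Haar measure $\mu$ = product of the uniform probability measures on $Z_{m_k}$; elements are $x=(x_0,x_1,\dots)$, $x_k\in Z_{m_k}$, and $x-t$ is coordinatewise subtraction mod $m_k$. Put $M_0=1$, $M_{k+1}=m_kM_k$. For $x\in G_m$, $I_0(x)=G_m$, $I_n(x)=\{y: y_j=x_j,\ 0\le j<n\}$, $I_n:=I_n(0)$. Every $n\in P$ is written uniquely as $n=\sum_j n_jM_j$ with $n_j\in Z_{m_j}$. Rademacher functions $r_k(x)=\exp(2\pi i x_k/m_k)$; Vilenkin system $\psi_n=\prod_k r_k^{n_k}$. Let $\mathcal F_n$ be the $\sigma$-algebra generated by the sets $I_n(x)$. For a martingale $f=(f^{(n)})_{n\in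 P}$ with respect to $(\mathcal F_n)$, $f^*=\sup_n|f^{(n)}|$, and for $0<p<\infty$ the Hardy space $H_p(G_m)$ consists of martingales with $\|f\|_{H_p}:=\|f^*\|_{L_p}<\infty$, where $\|g\|_{L_p}=(\int_{G_m}|g|^pd\mu)^{1/p}$. Fourier coefficients of a martingale: $\hat f(i)=\lim_{k\to\infty}\int_{G_m}f^{(k)}\overline{\psi_i}\,d\mu$. Partial sums $S_nf=\sum_{k=0}^{n-1}\hat f(k)\psi_k$ ($S_0f=0$), Fejér means $\sigma_nf=\frac1n\sum_{k=0}^{n-1}S_kf$ ($n\in P_+$). $\log$ denotes a fixed logarithm (e.g. natural). *)

(* Defs.v *)
From Stdlib Require Import Reals Lra Lia Arith.
Open Scope R_scope.

Definition Cx := (R * R)%type.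
Definition Cadd (z w : Cx) : Cx := (fst z + fst w, snd z + snd w).
Definition Cmul (z w : Cx) : Cx :=
  (fst z * fst w - snd z * snd w, fst z * snd w + snd z * fst w).
Definition Cscale (r : R) (z : Cx) : Cx := (r * fst z, r * snd z).
Definition Cconj (z : Cx) : Cx := (fst z, - snd z).
Definition Cmod (z : Cx) : R := sqrt (fst z ^ 2 + snd z ^ 2).
Definition C0 : Cx := (0, 0).

Fixpoint sumR (n : nat) (h : nat -> R) : R :=
  match n with O => 0 | S k => sumR k h + h k end.
Fixpoint sumC (n : nat) (h : nat -> Cx) : Cx :=
  match n with O => C0 | S k => Cadd (sumC k h) (h k) end.

Definition point := nat -> nat.
Definition inG (m : nat -> nat) (x : point) : Prop := forall k, (x k < m k)%nat.
Definition upd (x : point) (k a : nat) : point :=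
  fun j => if Nat.eqb j k then a else x j.

Fixpoint Mk (m : nat -> nat) (k : nat) : nat :=
  match k with O => 1%nat | S k' => (m k' * Mk m k')%nat end.

(** Haar integral of an F_n-measurable function g (one depending only on
    x_0..x_{n-1}): average of g over all prefixes (coordinates >= n are 0). *)
Fixpoint avg_from (m : nat -> nat) (k n : nat) (g : point -> R) (z : point) : R :=
  match n with
  | O => g z
  | S n' => / INR (m k) * sumR (m k) (fun a => avg_from m (S k) n' g (upd z k a))
  end.
Definition integral_lvl (m : nat -> nat) (n : nat) (g : point -> R) : R :=
  avg_from m 0 n g (fun _ => 0%nat).
Definition Cintegral_lvl (m : nat -> nat) (n : nat) (g : point -> Cx) : Cx :=
  (integral_lvl m n (fun x => fst (g x)), integral_lvl m n (fun x => snd (g x))).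

Definition digit (m : nat -> nat) (n k : nat) : nat := ((n / Mk m k) mod (m k))%nat.

(** Vilenkin function psi_n(x) = prod_k r_k(x)^{n_k}
      = exp(2 pi i sum_k n_k x_k / m_k); digits n_k vanish for k > n. *)
Definition psi (m : nat -> nat) (n : nat) (x : point) : Cx :=
  let th := 2 * PI * sumR (S n) (fun k => INR (digit m n k * x k) / INR (m k)) in
  (cos th, sin th).

(** Martingales w.r.t. (F_n): f n is F_n-measurable and E(f^(n+1) | F_n) = f^(n). *)
Definition martingale (m : nat -> nat) (f : nat -> point -> Cx) : Prop :=
  (forall n x y, inG m x -> inG m y -> (forall j, (j < n)%nat -> x j = y j) ->
     f n x = f n y) /\
  (forall n x, inG m x ->
     f n x = Cscale (/ INR (m n)) (sumC (m n) (fun a => f (S n) (upd x n a)))).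

(** Fourier coefficient: lim_k int f^(k) conj(psi_i); for a martingale the
    sequence is constant for k >= i+1 (psi_i is F_{i+1}-measurable), so the
    limit equals the value at k = i+1. *)
Definition fourier (m : nat -> nat) (f : nat -> point -> Cx) (i : nat) : Cx :=
  Cintegral_lvl m (S i) (fun x => Cmul (f (S i) x) (Cconj (psi m i x))).

Definition Spart (m : nat -> nat) (f : nat -> point -> Cx) (n : nat) (x : point) : Cx :=
  sumC n (fun k => Cmul (fourier m f k) (psi m k x)).

Definition fejer (m : nat -> nat) (f : nat -> point -> Cx) (n : nat) (x : point) : Cx :=
  Cscale (/ INR n) (sumC n (fun k => Spart m f k x)).

Fixpoint maxH (f : nat -> point -> Cx) (N : nat) (x : point) : R :=
  match N with
  | O => Cmod (f O x)
  | S N' => Rmax (maxH f N' x) (Cmod (f N x))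
  end.

Fixpoint maxSig (m : nat -> nat) (f : nat -> point -> Cx) (N : nat) (x : point) : R :=
  match N with
  | O => 0
  | S N' => Rmax (maxSig m f N' x) (Cmod (fejer m f N x) / (ln (INR (N + 1))) ^ 2)
  end.

(** || max_{n<=N} |f^(n)| ||_{L_{1/2}}; the integrand is F_N-measurable.
    By monotone convergence ||f||_{H_{1/2}} = sup_N Hnorm_approx m f N. *)
Definition Hnorm_approx (m : nat -> nat) (f : nat -> point -> Cx) (N : nat) : R :=
  (integral_lvl m N (fun x => sqrt (maxH f N x))) ^ 2.

(** || max_{1<=n<=N} |sigma_n f|/log^2(n+1) ||_{L_{1/2}}; integrand is
    F_N-measurable. By monotone convergence the L_{1/2} quasi-norm of the
    full maximal operator is sup_N Snorm_approx m f N. *)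
Definition Snorm_approx (m : nat -> nat) (f : nat -> point -> Cx) (N : nat) : R :=
  (integral_lvl m N (fun x => sqrt (maxSig m f N x))) ^ 2.

(* Main.v *)
From Stdlib Require Import Reals Lra Lia Arith.
From Coquelicot Require Complex.
Require Import Defs.
Open Scope R_scope.

(** The martingale is split along stopping times into atoms: functions of conditional mean zero
    over F_a, bounded by [lam] on an F_a-measurable set [A] and vanishing outside it. With
    L_n = n K_n the unnormalised Fejer kernel, the block recursion
    L_{q M_A + s} = L_{q M_A} + s D_{q M_A} + r_A^q L_s and D_{M_A} = M_A 1_{I_A} give
    |L_n| <= C sum_{t <= A <= |n|} M_t M_A E_{t,A}, where E_{t,A} is the indicator that the
    coordinates below A other than the t-th vanish. Averaging over cells of level a collapses
    the terms A > a, so for n >= M_a the Fejer mean of an atom is at most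
    lam C M_a^{-1} sum_{t <= A <= a} M_t M_A (1_set * E_{t,A}), while for n < M_a it is zero.
    Since the convolution is a sum over M_a cells, its square root is at most M_a^{1/2} times
    the convolution of the square roots; integrating, the sum over t <= A of (M_t / M_A)^{1/2}
    is bounded, the sum over A <= a contributes a + 1, and this is what log (n + 1) absorbs.

    The martingale is stopped at the thresholds eps 2^k; the increments between consecutive
    stopped martingales are sums of atoms of height 4 eps 2^k, and since the group is bounded
    the stopping probability is at most K times that of f^* > eps 2^k. Summing over k gives
    the integral of (f^* )^{1/2}. *)

(** * Finite sums *)

Lemma sumR_ext n g h :
  (forall i, (i < n)%nat -> g i = h i) -> sumR n g = sumR n h.
Proof.
  induction n as [|n IH]; intros H; simpl; [reflexivity|].
  rewrite IH by (intros; apply H; lia). rewrite H by lia. reflexivity.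
Qed.

Lemma sumR_le n g h :
  (forall i, (i < n)%nat -> g i <= h i) -> sumR n g <= sumR n h.
Proof.
  induction n as [|n IH]; intros H; simpl; [lra|].
  apply Rplus_le_compat; [apply IH; intros; apply H; lia | apply H; lia].
Qed.

Lemma sumR_plus n g h : sumR n (fun i => g i + h i) = sumR n g + sumR n h.
Proof. induction n as [|n IH]; simpl; [lra|rewrite IH; lra]. Qed.

Lemma sumR_scal n c g : sumR n (fun i => c * g i) = c * sumR n g.
Proof. induction n as [|n IH]; simpl; [lra|rewrite IH; lra]. Qed.

Lemma sumR_const n c : sumR n (fun _ => c) = INR n * c.
Proof. induction n as [|n IH]; [simpl; lra|]. cbn [sumR]. rewrite IH, S_INR. lra. Qed.

Lemma sumR_nonneg n g : (forall i, (i < n)%nat -> 0 <= g i) -> 0 <= sumR n g.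
Proof.
  intros H. rewrite <- (Rmult_0_r (INR n)), <- sumR_const. now apply sumR_le.
Qed.

Lemma sumR_term_le n g i :
  (forall j, (j < n)%nat -> 0 <= g j) -> (i < n)%nat -> g i <= sumR n g.
Proof.
  induction n as [|n IH]; intros H Hi; [lia|]. simpl.
  pose proof (H n ltac:(lia)).
  destruct (Nat.eq_dec i n) as [->|Hin].
  - pose proof (sumR_nonneg n g ltac:(intros; apply H; lia)). lra.
  - pose proof (IH ltac:(intros; apply H; lia) ltac:(lia)). lra.
Qed.

Lemma sumR_add n p g : sumR (n + p) g = sumR n g + sumR p (fun i => g (n + i)%nat).
Proof.
  induction p as [|p IH]; simpl.
  - rewrite Nat.add_0_r. lra.
  - rewrite Nat.add_succ_r. simpl. rewrite IH. lra.
Qed.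

Lemma sumR_widen n p g :
  (n <= p)%nat -> (forall i, (n <= i < p)%nat -> 0 <= g i) -> sumR n g <= sumR p g.
Proof.
  intros Hnp H. replace p with (n + (p - n))%nat by lia. rewrite sumR_add.
  pose proof (sumR_nonneg (p - n) (fun i => g (n + i)%nat) ltac:(intros; apply H; lia)). lra.
Qed.

Lemma sumR_indicator n (i0 : nat) c :
  (i0 < n)%nat -> sumR n (fun i => if Nat.eqb i0 i then c else 0) = c.
Proof.
  intros H. induction n as [|n IH]; [lia|]. simpl.
  destruct (Nat.eqb_spec i0 n) as [->|Hn].
  - rewrite (sumR_ext n _ (fun _ => 0)); [rewrite sumR_const; lra|].
    intros i Hi. destruct (Nat.eqb_spec n i); [lia|reflexivity].
  - rewrite IH by lia. lra.
Qed.

Lemma sqrt_sum_le a b : 0 <= a -> 0 <= b -> sqrt (a + b) <= sqrt a + sqrt b.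
Proof.
  intros Ha Hb. pose proof (sqrt_pos a). pose proof (sqrt_pos b).
  apply Rsqr_incr_0_var; [|lra]. rewrite Rsqr_sqrt by lra.
  unfold Rsqr. pose proof (sqrt_sqrt a Ha). pose proof (sqrt_sqrt b Hb). nra.
Qed.

Lemma sqrt_sumR_le n g :
  (forall i, (i < n)%nat -> 0 <= g i) -> sqrt (sumR n g) <= sumR n (fun i => sqrt (g i)).
Proof.
  induction n as [|n IH]; intros H; simpl; [rewrite sqrt_0; lra|].
  eapply Rle_trans; [apply sqrt_sum_le|].
  - apply sumR_nonneg. intros; apply H; lia.
  - apply H; lia.
  - apply Rplus_le_compat_r, IH. intros; apply H; lia.
Qed.

(** * Complex numbers *)

(** The pairs and operations of [Cx] are convertible with those of Coquelicot, so its results on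
    moduli apply by [exact]. *)
Lemma Cmod_add z w : (Cmod (Cadd z w) <= Cmod z + Cmod w)%R.
Proof. exact (Complex.Cmod_triangle z w). Qed.

Lemma Cmod_mul z w : Cmod (Cmul z w) = (Cmod z * Cmod w)%R.
Proof. exact (Complex.Cmod_mult z w). Qed.

Lemma Cmod_ge0 z : (0 <= Cmod z)%R.
Proof. exact (Complex.Cmod_ge_0 z). Qed.

Lemma Cmod_C0 : Cmod C0 = 0.
Proof. exact Complex.Cmod_0. Qed.

Lemma Cx_eq (z w : Cx) : fst z = fst w -> snd z = snd w -> z = w.
Proof. destruct z, w; simpl; congruence. Qed.

Ltac cx := apply Cx_eq; unfold Cadd, Cmul, Cscale, Cconj, C0; simpl; ring.

Lemma Cmod_scale r z : 0 <= r -> Cmod (Cscale r z) = r * Cmod z.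
Proof.
  intros Hr. replace (Cscale r z) with (Cmul (r, 0) z) by cx.
  rewrite Cmod_mul. f_equal. unfold Cmod; simpl.
  replace (r * (r * 1) + 0 * (0 * 1)) with (r * r) by ring. now apply sqrt_square.
Qed.

Lemma sumC_ext n g h :
  (forall i, (i < n)%nat -> g i = h i) -> sumC n g = sumC n h.
Proof.
  induction n as [|n IH]; intros H; simpl; [reflexivity|].
  rewrite IH by (intros; apply H; lia). rewrite H by lia. reflexivity.
Qed.

Lemma fst_sumC n g : fst (sumC n g) = sumR n (fun i => fst (g i)).
Proof. induction n as [|n IH]; simpl; [reflexivity|now rewrite IH]. Qed.

Lemma snd_sumC n g : snd (sumC n g) = sumR n (fun i => snd (g i)).
Proof. induction n as [|n IH]; simpl; [reflexivity|now rewrite IH]. Qed.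

Lemma Cmul_sumC n c g : Cmul c (sumC n g) = sumC n (fun i => Cmul c (g i)).
Proof. induction n as [|n IH]; simpl; [cx|]. rewrite <- IH. cx. Qed.

Lemma sumC_add_range n p g :
  sumC (n + p) g = Cadd (sumC n g) (sumC p (fun i => g (n + i)%nat)).
Proof.
  induction p as [|p IH]; simpl.
  - rewrite Nat.add_0_r. cx.
  - rewrite Nat.add_succ_r. simpl. rewrite IH. cx.
Qed.

Lemma Cmod_sumC n g : Cmod (sumC n g) <= sumR n (fun i => Cmod (g i)).
Proof.
  induction n as [|n IH]; simpl; [rewrite Cmod_C0; lra|].
  eapply Rle_trans; [apply Cmod_add|]. lra.
Qed.

(** * Unimodular exponentials and sums over roots of unity *)

Definition cis (t : R) : Cx := (cos t, sin t).

Lemma cis_plus s t : cis (s + t) = Cmul (cis s) (cis t).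
Proof. unfold cis, Cmul; simpl. rewrite cos_plus, sin_plus. f_equal; ring. Qed.

Lemma Cmod_cis t : Cmod (cis t) = 1.
Proof.
  unfold Cmod, cis. transitivity (sqrt 1); [f_equal; simpl|apply sqrt_1].
  pose proof (sin2_cos2 t) as H. unfold Rsqr in H. lra.
Qed.

Lemma cis_0 : cis 0 = (1, 0).
Proof. unfold cis. now rewrite cos_0, sin_0. Qed.

Lemma cis_2PI_mult (k : nat) : cis (2 * PI * INR k) = (1, 0).
Proof.
  rewrite <- cis_0. unfold cis.
  replace (2 * PI * INR k) with (0 + 2 * INR k * PI) by ring.
  now rewrite cos_period, sin_period.
Qed.

Lemma cis_opp t : cis (- t) = Cconj (cis t).
Proof. unfold cis, Cconj; simpl. now rewrite cos_neg, sin_neg. Qed.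

Lemma cos_lt_1 t : 0 < t < 2 * PI -> cos t < 1.
Proof.
  intros H. replace t with (2 * (t / 2)) by field. rewrite cos_2a_sin.
  pose proof (sin_gt_0 (t / 2) ltac:(lra) ltac:(lra)). nra.
Qed.

(** Multiplying by [cis t] - 1 keeps the telescoping identity free of division, so it holds also
    when [cis t] is 1. *)
Lemma geometric_cis n t :
  Cmul (Cadd (cis t) (-1, 0)) (sumC n (fun u => cis (INR u * t)))
  = Cadd (cis (INR n * t)) (-1, 0).
Proof.
  induction n as [|n IH].
  - simpl sumC. simpl INR. rewrite Rmult_0_l, cis_0. cx.
  - cbn [sumC]. rewrite S_INR.
    replace ((INR n + 1) * t) with (INR n * t + t) by ring. rewrite cis_plus.
    transitivity (Cadd (Cmul (Cadd (cis t) (-1, 0)) (sumC n (fun u => cis (INR u * t))))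
                    (Cmul (Cadd (cis t) (-1, 0)) (cis (INR n * t)))); [cx|].
    rewrite IH. cx.
Qed.

Lemma Cmul_eq0 z w : Cmul z w = C0 -> z <> C0 -> w = C0.
Proof.
  intros H Hz. destruct (Complex.Ceq_dec w C0) as [E|E]; [exact E|].
  exfalso. exact (Complex.Cmult_neq_0 z w Hz E H).
Qed.

(** Orthogonality of the characters of Z_n: for [x <> y] the sum times [cis t] - 1 vanishes, because
    n t is a multiple of 2 pi, while [cis t] is not 1. *)
Lemma root_of_unity_sum (n x y : nat) :
  (x < n)%nat -> (y < n)%nat ->
  sumC n (fun u => cis (INR u * (2 * PI * (INR x - INR y) / INR n)))
  = if Nat.eqb x y then (INR n, 0) else C0.
Proof.
  intros Hx Hy.
  assert (Hn : 0 < INR n) by (apply lt_0_INR; lia).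
  destruct (Nat.eqb_spec x y) as [->|Hxy].
  - rewrite (sumC_ext n _ (fun _ => (1, 0))).
    + apply Cx_eq; [rewrite fst_sumC|rewrite snd_sumC]; simpl; rewrite sumR_const; ring.
    + intros u _. rewrite <- cis_0. f_equal. field. lra.
  - set (t := 2 * PI * (INR x - INR y) / INR n).
    assert (Hper : cis (INR n * t) = (1, 0)).
    { replace (INR n * t) with (2 * PI * (INR x - INR y)) by (unfold t; field; lra).
      destruct (le_lt_dec y x).
      - rewrite <- minus_INR by lia. apply cis_2PI_mult.
      - replace (2 * PI * (INR x - INR y)) with (- (2 * PI * INR (y - x)))
          by (rewrite minus_INR by lia; ring).
        rewrite cis_opp, cis_2PI_mult. cx. }
    apply (Cmul_eq0 (Cadd (cis t) (-1, 0))).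
    + rewrite geometric_cis, Hper. cx.
    + intros E. assert (Hc : cos t = 1).
      { apply (f_equal fst) in E. simpl in E. lra. }
      pose proof PI_RGT_0.
      (* An angle strictly between 0 and 2 pi has cosine below 1; evenness of the cosine takes care
         of the order of [x] and [y]. *)
      assert (Hlt : forall p q : nat, (p < q)%nat -> (q < n)%nat ->
                0 < 2 * PI * (INR q - INR p) / INR n < 2 * PI).
      { intros p q Hpq Hq. apply lt_INR in Hpq, Hq. pose proof (pos_INR p).
        split.
        - apply Rdiv_lt_0_compat; nra.
        - apply Rmult_lt_reg_r with (INR n); [lra|].
          unfold Rdiv. rewrite Rmult_assoc, Rinv_l by lra. nra. }
      destruct (le_lt_dec x y).
      * pose proof (cos_lt_1 _ (Hlt x y ltac:(lia) Hy)) as Hc'.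
        rewrite <- cos_neg in Hc'. apply (Rlt_irrefl 1). rewrite <- Hc at 1.
        eapply Rle_lt_trans; [|exact Hc']. right. f_equal. unfold t. field. lra.
      * pose proof (cos_lt_1 _ (Hlt y x ltac:(lia) Hx)) as Hc'. fold t in Hc'. lra.
Qed.

Section Vilenkin.

Variable m : nat -> nat.
Variable K : nat.
Hypothesis Hm2 : forall k, (2 <= m k)%nat.
Hypothesis HK : forall k, (m k <= K)%nat.

Notation G := (inG m).
Notation M k := (INR (Mk m k)).

Lemma INR_m_ge2 k : 2 <= INR (m k).
Proof. apply (le_INR 2), Hm2. Qed.

Lemma INR_m_leK k : INR (m k) <= INR K.
Proof. apply le_INR, HK. Qed.

Lemma K_ge2 : 2 <= INR K.
Proof. pose proof (INR_m_ge2 0). pose proof (INR_m_leK 0). lra. Qed.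

Lemma Mk_S k : M (S k) = INR (m k) * M k.
Proof. simpl Mk. apply mult_INR. Qed.

Lemma Mk_ge1 k : 1 <= M k.
Proof.
  induction k as [|k IH]; [simpl; lra|]. rewrite Mk_S. pose proof (INR_m_ge2 k). nra.
Qed.

Lemma Mk_pos k : (0 < Mk m k)%nat.
Proof. apply INR_lt. pose proof (Mk_ge1 k). simpl. lra. Qed.

Lemma Mk_add_ge a i : 2 ^ i * M a <= M (a + i).
Proof.
  induction i as [|i IH]; [rewrite Nat.add_0_r; simpl; lra|].
  rewrite Nat.add_succ_r, Mk_S. pose proof (INR_m_ge2 (a + i)).
  pose proof (Mk_ge1 (a + i)). simpl. nra.
Qed.

Lemma Mk_gt_id k : (k < Mk m k)%nat.
Proof.
  induction k as [|k IH]; simpl; [lia|]. pose proof (Hm2 k). nia.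
Qed.

Lemma Mk_le a b : (a <= b)%nat -> (Mk m a <= Mk m b)%nat.
Proof.
  induction 1 as [|b Hab IH]; [lia|]. simpl. pose proof (Hm2 b). nia.
Qed.

Lemma sum_Mk_le A : sumR A (fun t => M t) <= M A.
Proof.
  induction A as [|A IH]; [simpl; lra|]. cbn [sumR]. rewrite Mk_S.
  pose proof (INR_m_ge2 A). pose proof (Mk_ge1 A). nra.
Qed.

(** * Haar averages *)

Lemma G_zero : G (fun _ => 0%nat).
Proof. intros k. pose proof (Hm2 k). lia. Qed.

Lemma G_upd x k a : G x -> (a < m k)%nat -> G (upd x k a).
Proof.
  intros Hx Ha j. unfold upd. destruct (Nat.eqb_spec j k) as [->|]; auto.
Qed.

Lemma upd_same x k a : upd x k a k = a.
Proof. unfold upd. now rewrite Nat.eqb_refl. Qed.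

Lemma upd_other x k a j : j <> k -> upd x k a j = x j.
Proof. intros H. unfold upd. destruct (Nat.eqb_spec j k); congruence. Qed.

(* F_n-measurability. *)
Definition dep {T} (n : nat) (u : point -> T) : Prop :=
  forall x y, G x -> G y -> (forall j, (j < n)%nat -> x j = y j) -> u x = u y.

Lemma dep_mono {T} n p (u : point -> T) : (n <= p)%nat -> dep n u -> dep p u.
Proof. intros H Hu x y Hx Hy Hxy. apply Hu; auto. intros; apply Hxy; lia. Qed.

Lemma dep_upd {T} n k (u : point -> T) x a :
  dep n u -> (n <= k)%nat -> G x -> (a < m k)%nat -> u (upd x k a) = u x.
Proof.
  intros Hu Hk Hx Ha. apply Hu; auto using G_upd.
  intros j Hj. apply upd_other. lia.
Qed.

Lemma avg_ext_cell k n g h z :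
  G z -> (forall x, G x -> (forall j, (j < k)%nat -> x j = z j) -> g x = h x) ->
  avg_from m k n g z = avg_from m k n h z.
Proof.
  revert k z. induction n as [|n IH]; intros k z Hz H; simpl; auto.
  f_equal. apply sumR_ext. intros a Ha. apply IH; auto using G_upd.
  intros x Hx Hxz. apply H; auto. intros j Hj. rewrite Hxz by lia. apply upd_other. lia.
Qed.

Lemma avg_ext k n g h z :
  G z -> (forall x, G x -> g x = h x) -> avg_from m k n g z = avg_from m k n h z.
Proof. intros Hz H. apply avg_ext_cell; auto. Qed.

Lemma avg_le k n g h z :
  G z -> (forall x, G x -> g x <= h x) -> avg_from m k n g z <= avg_from m k n h z.
Proof.
  revert k z. induction n as [|n IH]; intros k z Hz H; simpl; auto.
  pose proof (INR_m_ge2 k).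
  apply Rmult_le_compat_l; [left; apply Rinv_0_lt_compat; lra|].
  apply sumR_le. intros a Ha. apply IH; auto using G_upd.
Qed.

Lemma avg_plus k n g h z :
  avg_from m k n (fun x => g x + h x) z = avg_from m k n g z + avg_from m k n h z.
Proof.
  revert k z. induction n as [|n IH]; intros k z; simpl; [reflexivity|].
  rewrite (sumR_ext _ _ (fun a => avg_from m (S k) n g (upd z k a)
                                + avg_from m (S k) n h (upd z k a))) by auto.
  rewrite sumR_plus. ring.
Qed.

Lemma avg_scal k n c g z :
  avg_from m k n (fun x => c * g x) z = c * avg_from m k n g z.
Proof.
  revert k z. induction n as [|n IH]; intros k z; simpl; [reflexivity|].
  rewrite (sumR_ext _ _ (fun a => c * avg_from m (S k) n g (upd z k a))) by auto.
  rewrite sumR_scal. ring.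
Qed.

Lemma avg_const k n c z : avg_from m k n (fun _ => c) z = c.
Proof.
  revert k z. induction n as [|n IH]; intros k z; simpl; [reflexivity|].
  rewrite (sumR_ext _ _ (fun _ => c)) by auto.
  rewrite sumR_const. pose proof (INR_m_ge2 k). field. lra.
Qed.

Lemma avg_nonneg k n g z :
  G z -> (forall x, G x -> 0 <= g x) -> 0 <= avg_from m k n g z.
Proof. intros Hz H. rewrite <- (avg_const k n 0 z). now apply avg_le. Qed.

Lemma avg_sumR k n p (g : nat -> point -> R) z :
  avg_from m k n (fun x => sumR p (fun i => g i x)) z
  = sumR p (fun i => avg_from m k n (g i) z).
Proof.
  induction p as [|p IH]; simpl; [apply avg_const|].
  now rewrite avg_plus, IH.
Qed.

Lemma avg_swap k n k' n' (h : point -> point -> R) z z' :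
  G z -> G z' ->
  avg_from m k n (fun x => avg_from m k' n' (fun y => h x y) z') z
  = avg_from m k' n' (fun y => avg_from m k n (fun x => h x y) z) z'.
Proof.
  intros Hz Hz'. revert k z Hz. induction n as [|n IH]; intros k z Hz; simpl; [reflexivity|].
  rewrite (sumR_ext _ _ (fun a => avg_from m k' n'
            (fun y => avg_from m (S k) n (fun x => h x y) (upd z k a)) z'))
    by auto using G_upd.
  now rewrite <- avg_sumR, <- avg_scal.
Qed.

Lemma avg_tower k n p g z :
  avg_from m k (n + p) g z = avg_from m k n (fun x => avg_from m (k + n) p g x) z.
Proof.
  revert k z. induction n as [|n IH]; intros k z; simpl.
  - now rewrite Nat.add_0_r.
  - f_equal. apply sumR_ext. intros a _. rewrite IH. now rewrite Nat.add_succ_r.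
Qed.

(** [avg_from m k n] at [z] is a conditional expectation over F_k: the coordinates below [k] stay
    fixed, so an F_k-measurable factor comes out. *)
Lemma avg_mul_dep k n u g z :
  G z -> dep k u -> avg_from m k n (fun x => u x * g x) z = u z * avg_from m k n g z.
Proof.
  revert k z. induction n as [|n IH]; intros k z Hz Hu; simpl; [reflexivity|].
  rewrite (sumR_ext _ _ (fun a => u z * avg_from m (S k) n g (upd z k a))).
  - rewrite sumR_scal. ring.
  - intros a Ha. rewrite IH; [|auto using G_upd|apply (dep_mono k); [lia|exact Hu]].
    now rewrite (dep_upd k).
Qed.

Lemma avg_dep_id k n u z : G z -> dep k u -> avg_from m k n u z = u z.
Proof.
  intros Hz Hu. rewrite (avg_ext k n u (fun x => u x * 1)) by (auto; intros; ring).
  rewrite avg_mul_dep, avg_const by assumption. ring.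
Qed.

Lemma avg_split a N g z :
  (a <= N)%nat ->
  avg_from m 0 N g z = avg_from m 0 a (fun x => avg_from m a (N - a) g x) z.
Proof. intros H. replace N with (a + (N - a))%nat at 1 by lia. apply avg_tower. Qed.

(** The average runs over M_{k+n} / M_k values, so subadditivity of the square root costs (M_{k+n} /
    M_k)^{1/2}; the form without quotients suits the induction. *)
Lemma sqrt_avg_le k n h z :
  G z -> (forall x, G x -> 0 <= h x) ->
  sqrt (M k) * sqrt (avg_from m k n h z)
  <= sqrt (M (k + n)) * avg_from m k n (fun x => sqrt (h x)) z.
Proof.
  revert k z. induction n as [|n IH]; intros k z Hz Hh; simpl.
  - rewrite Nat.add_0_r. lra.
  - pose proof (INR_m_ge2 k). pose proof (Mk_ge1 k).
    set (u := fun a => avg_from m (S k) n h (upd z k a)).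
    assert (Hu : forall a, (a < m k)%nat -> 0 <= u a)
      by (intros; apply avg_nonneg; auto using G_upd).
    pose proof (sumR_nonneg _ _ Hu) as Hs.
    rewrite <- sqrt_mult by (try lra; (apply Rmult_le_pos; [left; apply Rinv_0_lt_compat; lra|exact Hs])).
    (* Extracting the square of 1 / m_k raises M_k to M_{k+1}, the weight in the induction
       hypothesis. *)
    replace (M k * (/ INR (m k) * sumR (m k) u))
      with ((M (S k) * sumR (m k) u) * Rsqr (/ INR (m k)))
      by (rewrite Mk_S; unfold Rsqr; field; lra).
    pose proof (Mk_ge1 (S k)).
    assert (Hi : 0 < / INR (m k)) by (apply Rinv_0_lt_compat; lra).
    rewrite sqrt_mult, sqrt_Rsqr, sqrt_mult by (try apply Rle_0_sqr; try nra; try lra).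
    rewrite (Rmult_comm _ (/ _)).
    replace (sqrt (M (k + S n)) * (/ INR (m k) * sumR (m k) (fun a => avg_from m (S k) n (fun x => sqrt (h x)) (upd z k a))))
      with (/ INR (m k) * (sqrt (M (k + S n)) * sumR (m k) (fun a => avg_from m (S k) n (fun x => sqrt (h x)) (upd z k a)))) by ring.
    apply Rmult_le_compat_l; [lra|].
    eapply Rle_trans.
    + apply Rmult_le_compat_l; [apply sqrt_pos|]. now apply sqrt_sumR_le.
    + rewrite <- !sumR_scal. apply sumR_le. intros a Ha. unfold u.
      replace (k + S n)%nat with (S k + n)%nat by lia. apply IH; auto using G_upd.
Qed.

(** An F_a-measurable function has only M_a cells, so the loss does not depend on [N]. *)
Lemma sqrt_integral_dep_le a N h :
  (a <= N)%nat -> dep a h -> (forall x, G x -> 0 <= h x) ->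
  sqrt (integral_lvl m N h) <= sqrt (M a) * integral_lvl m N (fun x => sqrt (h x)).
Proof.
  intros HaN Hd Hh. unfold integral_lvl. pose proof G_zero as Hz.
  assert (Hds : dep a (fun x => sqrt (h x))).
  { intros x y Hx Hy Hxy. f_equal. now apply Hd. }
  rewrite !(avg_split a N) by assumption.
  rewrite (avg_ext 0 a _ h) by (auto; intros; now apply avg_dep_id).
  rewrite (avg_ext 0 a (fun x => avg_from m a (N - a) (fun x0 => sqrt (h x0)) x)
             (fun x => sqrt (h x))) by (auto; intros; now apply (avg_dep_id a _ (fun x => sqrt (h x)))).
  pose proof (sqrt_avg_le 0 a h _ Hz Hh) as H. simpl in H. rewrite sqrt_1 in H. lra.
Qed.

(** * Averages of complex-valued functions *)

Definition Cavg k n (g : point -> Cx) z : Cx :=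
  (avg_from m k n (fun x => fst (g x)) z, avg_from m k n (fun x => snd (g x)) z).

Lemma Cavg_S k n g z :
  Cavg k (S n) g z = Cscale (/ INR (m k)) (sumC (m k) (fun a => Cavg (S k) n g (upd z k a))).
Proof. apply Cx_eq; simpl; [rewrite fst_sumC|rewrite snd_sumC]; reflexivity. Qed.

Lemma Cavg_ext k n g h z :
  G z -> (forall x, G x -> g x = h x) -> Cavg k n g z = Cavg k n h z.
Proof. intros Hz H. unfold Cavg. f_equal; apply avg_ext; auto; intros; now rewrite H. Qed.

Lemma Cavg_ext_cell k n g h z :
  G z -> (forall x, G x -> (forall j, (j < k)%nat -> x j = z j) -> g x = h x) ->
  Cavg k n g z = Cavg k n h z.
Proof. intros Hz H. unfold Cavg. f_equal; apply avg_ext_cell; auto; intros; now rewrite H. Qed.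

Lemma Cavg_add k n g h z :
  Cavg k n (fun x => Cadd (g x) (h x)) z = Cadd (Cavg k n g z) (Cavg k n h z).
Proof. unfold Cavg, Cadd; simpl. now rewrite !avg_plus. Qed.

Lemma avg_scal_r k n c g z :
  avg_from m k n (fun x => g x * c) z = avg_from m k n g z * c.
Proof.
  revert k z. induction n as [|n IH]; intros k z; simpl; [reflexivity|].
  rewrite (sumR_ext _ _ (fun a => c * avg_from m (S k) n g (upd z k a))).
  - rewrite sumR_scal. ring.
  - intros. rewrite IH. ring.
Qed.

Lemma avg_minus k n g h z :
  avg_from m k n (fun x => g x - h x) z = avg_from m k n g z - avg_from m k n h z.
Proof.
  unfold Rminus. rewrite avg_plus. f_equal.
  transitivity (avg_from m k n (fun x => h x * -1) z).
  - revert k z. induction n as [|n IH]; intros k z; simpl; [ring|].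
    f_equal. apply sumR_ext. auto.
  - rewrite avg_scal_r. ring.
Qed.

Lemma Cavg_mul_dep k n u g z :
  G z -> dep k u -> Cavg k n (fun x => Cmul (u x) (g x)) z = Cmul (u z) (Cavg k n g z).
Proof.
  intros Hz Hu.
  assert (H1 : dep k (fun x => fst (u x))) by (intros x y Hx Hy Hxy; now rewrite (Hu x y)).
  assert (H2 : dep k (fun x => snd (u x))) by (intros x y Hx Hy Hxy; now rewrite (Hu x y)).
  unfold Cavg, Cmul; simpl. rewrite avg_minus, avg_plus.
  rewrite !(avg_mul_dep k n (fun x => fst (u x))), !(avg_mul_dep k n (fun x => snd (u x)))
    by assumption. reflexivity.
Qed.

Lemma Cavg_mul k n c g z :
  G z -> Cavg k n (fun x => Cmul c (g x)) z = Cmul c (Cavg k n g z).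
Proof. intros Hz. apply (Cavg_mul_dep k n (fun _ => c)); auto. intros x y; reflexivity. Qed.

Lemma Cavg_C0 k n z : Cavg k n (fun _ => C0) z = C0.
Proof. unfold Cavg, C0; simpl. now rewrite avg_const. Qed.

Lemma Cavg_sumC k n p (g : nat -> point -> Cx) z :
  Cavg k n (fun x => sumC p (fun i => g i x)) z = sumC p (fun i => Cavg k n (g i) z).
Proof.
  induction p as [|p IH]; simpl; [apply Cavg_C0|]. now rewrite Cavg_add, IH.
Qed.

Lemma Cavg_split a N g z :
  (a <= N)%nat -> Cavg 0 N g z = Cavg 0 a (fun x => Cavg a (N - a) g x) z.
Proof. intros H. unfold Cavg; simpl. now rewrite !(avg_split a N) by assumption. Qed.

Lemma Cavg_dep_id k n u z : G z -> dep k u -> Cavg k n u z = u z.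
Proof.
  intros Hz Hu. apply Cx_eq; simpl.
  - apply (avg_dep_id k n (fun x => fst (u x))); auto. intros x y Hx Hy Hxy; now rewrite (Hu x y).
  - apply (avg_dep_id k n (fun x => snd (u x))); auto. intros x y Hx Hy Hxy; now rewrite (Hu x y).
Qed.

Lemma Cmod_Cavg k n g z :
  G z -> Cmod (Cavg k n g z) <= avg_from m k n (fun x => Cmod (g x)) z.
Proof.
  revert k z. induction n as [|n IH]; intros k z Hz.
  - simpl. unfold Cavg; simpl. right. f_equal. now destruct (g z).
  - rewrite Cavg_S. pose proof (INR_m_ge2 k).
    assert (0 < / INR (m k)) by (apply Rinv_0_lt_compat; lra).
    rewrite Cmod_scale by lra. simpl. apply Rmult_le_compat_l; [lra|].
    eapply Rle_trans; [apply Cmod_sumC|]. apply sumR_le. auto using G_upd.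
Qed.

(** * Dirichlet and Fejer kernels *)

(** [cis (theta k x y)] is r_k(x - y): reducing the difference of coordinates mod m_k changes the
    angle by a multiple of 2 pi. *)
Definition theta k (x y : point) : R := 2 * PI * (INR (x k) - INR (y k)) / INR (m k).

(* The product of [psi j x] and the conjugate of [psi j y], so that no group subtraction is
   needed: every convolution kernel below is a function of two points. *)
Definition wker j (x y : point) : Cx :=
  cis (sumR (S j) (fun k => INR (digit m j k) * theta k x y)).

Definition Dker n x y : Cx := sumC n (fun j => wker j x y).
Definition Lker n x y : Cx := sumC n (fun k => Dker k x y).

Lemma psi_mul_conj j x y : Cmul (psi m j x) (Cconj (psi m j y)) = wker j x y.
Proof.
  unfold psi. fold (cis (2 * PI * sumR (S j) (fun k => INR (digit m j k * x k) / INR (m k)))).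
  fold (cis (2 * PI * sumR (S j) (fun k => INR (digit m j k * y k) / INR (m k)))).
  rewrite <- cis_opp, <- cis_plus. unfold wker. f_equal.
  rewrite Ropp_mult_distr_r, <- Rmult_plus_distr_l.
  replace (- sumR (S j) (fun k => INR (digit m j k * y k) / INR (m k)))
    with (-1 * sumR (S j) (fun k => INR (digit m j k * y k) / INR (m k))) by ring.
  rewrite <- sumR_scal, <- sumR_plus, <- sumR_scal. apply sumR_ext. intros k _.
  unfold theta. rewrite !mult_INR. pose proof (INR_m_ge2 k). field. lra.
Qed.

Lemma digit_small n k : (n < Mk m k)%nat -> digit m n k = 0%nat.
Proof.
  intros H. unfold digit. rewrite Nat.div_small by assumption.
  apply Nat.mod_small. pose proof (Hm2 k). lia.
Qed.

Lemma Mk_multiple k A : (k <= A)%nat -> exists c, Mk m A = (c * Mk m k)%nat.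
Proof.
  induction 1 as [|A H [c Hc]]; [exists 1%nat; lia|].
  exists (m A * c)%nat. simpl. rewrite Hc. ring.
Qed.

Lemma digit_low q A j k :
  (k < A)%nat -> digit m (q * Mk m A + j) k = digit m j k.
Proof.
  intros H. destruct (Mk_multiple (S k) A H) as [c Hc].
  unfold digit. rewrite Hc. simpl Mk. pose proof (Mk_pos k). pose proof (Hm2 k).
  replace (q * (c * (m k * Mk m k)) + j)%nat with ((q * c * m k) * Mk m k + j)%nat by ring.
  rewrite Nat.div_add_l by lia. rewrite Nat.add_comm. apply Nat.Div0.mod_add.
Qed.

Lemma digit_top q A j :
  (q < m A)%nat -> (j < Mk m A)%nat -> digit m (q * Mk m A + j) A = q.
Proof.
  intros Hq Hj. unfold digit. rewrite Nat.div_add_l by lia.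
  rewrite (Nat.div_small j) by assumption. rewrite Nat.add_0_r. now apply Nat.mod_small.
Qed.

(** Digits of [j] from position [A] on vanish, so the nominal range [S j] of the sum can be traded
    for [A], whichever of the two is longer. *)
Lemma wker_bound j A x y :
  (j < Mk m A)%nat -> wker j x y = cis (sumR A (fun k => INR (digit m j k) * theta k x y)).
Proof.
  intros Hj. unfold wker. f_equal.
  assert (Hgen : forall B, (j < Mk m B)%nat -> forall C, (B <= C)%nat ->
    sumR C (fun k => INR (digit m j k) * theta k x y)
    = sumR B (fun k => INR (digit m j k) * theta k x y)).
  { intros B HB C HBC. replace C with (B + (C - B))%nat by lia. rewrite sumR_add.
    rewrite (sumR_ext (C - B) _ (fun _ => 0)).
    - rewrite sumR_const. ring.
    - intros i _. rewrite digit_small; [simpl; ring|].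
      pose proof (Mk_le B (B + i) ltac:(lia)). lia. }
  pose proof (Mk_gt_id (S j)).
  destruct (le_lt_dec A (S j)).
  - now apply Hgen.
  - symmetry. apply Hgen; lia.
Qed.

(** Adding q M_A to j < M_A changes only the digit at [A], from 0 to q. *)
Lemma wker_shift q A j x y :
  (q < m A)%nat -> (j < Mk m A)%nat ->
  wker (q * Mk m A + j) x y = Cmul (cis (INR q * theta A x y)) (wker j x y).
Proof.
  intros Hq Hj. rewrite (wker_bound _ (S A)) by (simpl; nia).
  rewrite (wker_bound j A) by assumption. rewrite <- cis_plus. f_equal.
  cbn [sumR]. rewrite digit_top by assumption. rewrite Rplus_comm. f_equal.
  apply sumR_ext. intros k Hk. now rewrite digit_low.
Qed.

Lemma wker_dep j A x : (j < Mk m A)%nat -> dep A (wker j x).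
Proof.
  intros Hj y z Hy Hz Hyz. rewrite !(wker_bound j A) by assumption. f_equal.
  apply sumR_ext. intros k Hk. unfold theta. now rewrite Hyz.
Qed.

Lemma Dker_block q A j x y :
  (q < m A)%nat -> (j <= Mk m A)%nat ->
  Dker (q * Mk m A + j) x y
  = Cadd (Dker (q * Mk m A) x y) (Cmul (cis (INR q * theta A x y)) (Dker j x y)).
Proof.
  intros Hq Hj. unfold Dker. rewrite sumC_add_range, Cmul_sumC. f_equal.
  apply sumC_ext. intros i Hi. apply wker_shift; lia.
Qed.

(** For k < s one has D_{q M_A + k} = D_{q M_A} + r_A^q D_k; summing over k gives s copies of the
    first term and r_A^q L_s. *)
Lemma Lker_block q A s x y :
  (q < m A)%nat -> (s <= Mk m A)%nat ->
  Lker (q * Mk m A + s) x y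
  = Cadd (Lker (q * Mk m A) x y)
      (Cadd (Cscale (INR s) (Dker (q * Mk m A) x y))
         (Cmul (cis (INR q * theta A x y)) (Lker s x y))).
Proof.
  intros Hq. induction s as [|s IH]; intros Hs.
  - rewrite Nat.add_0_r. unfold Lker at 3. simpl. cx.
  - rewrite Nat.add_succ_r. unfold Lker in *. cbn [sumC]. rewrite IH by lia.
    rewrite Dker_block by lia. rewrite S_INR. cx.
Qed.

Lemma Dker_mult q A x y :
  (q <= m A)%nat ->
  Dker (q * Mk m A) x y
  = Cmul (sumC q (fun u => cis (INR u * theta A x y))) (Dker (Mk m A) x y).
Proof.
  induction q as [|q IH]; intros Hq.
  - unfold Dker at 1. simpl. cx.
  - replace (S q * Mk m A)%nat with (q * Mk m A + Mk m A)%nat by ring.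
    rewrite Dker_block, IH by lia. cbn [sumC]. cx.
Qed.

Lemma Lker_mult q A x y :
  (q <= m A)%nat ->
  Lker (q * Mk m A) x y
  = Cadd (Cscale (M A) (sumC q (fun u => Dker (u * Mk m A) x y)))
      (Cmul (sumC q (fun u => cis (INR u * theta A x y))) (Lker (Mk m A) x y)).
Proof.
  induction q as [|q IH]; intros Hq.
  - unfold Lker at 1. simpl. cx.
  - replace (S q * Mk m A)%nat with (q * Mk m A + Mk m A)%nat by ring.
    rewrite Lker_block, IH by lia. cbn [sumC]. cx.
Qed.

Lemma Lker_dep n A x : (n <= Mk m A)%nat -> dep A (Lker n x).
Proof.
  intros Hn y z Hy Hz Hyz. unfold Lker, Dker.
  apply sumC_ext. intros k Hk. apply sumC_ext. intros j Hj.
  apply (wker_dep j A); auto. lia.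
Qed.

(** * Indicators and pointwise kernel bounds *)

(** When [A <= t] no coordinate is exempt, so [Eind A A x] is the indicator of the cell I_A(x). *)
Fixpoint Eind (t A : nat) (x y : point) : R :=
  match A with
  | O => 1
  | S A' => Eind t A' x y *
            (if Nat.eqb A' t then 1 else if Nat.eqb (x A') (y A') then 1 else 0)
  end.

Lemma Eind_01 t A x y : Eind t A x y = 0 \/ Eind t A x y = 1.
Proof.
  induction A as [|A IH]; simpl; [now right|].
  destruct (Nat.eqb A t), (Nat.eqb (x A) (y A)), IH as [-> | ->]; lra.
Qed.

Lemma Eind_nonneg t A x y : 0 <= Eind t A x y.
Proof. destruct (Eind_01 t A x y); lra. Qed.

Lemma Eind_outside t t' A x y :
  (A <= t)%nat -> (A <= t')%nat -> Eind t A x y = Eind t' A x y.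
Proof.
  induction A as [|A IH]; intros H H'; simpl; [reflexivity|].
  rewrite IH by lia.
  destruct (Nat.eqb_spec A t), (Nat.eqb_spec A t'); try lia. reflexivity.
Qed.

Lemma Eind_dep t A a x : (A <= a)%nat -> dep a (Eind t A x).
Proof.
  intros Ha y z Hy Hz Hyz. induction A as [|A IH]; simpl; [reflexivity|].
  rewrite IH by lia. now rewrite (Hyz A) by lia.
Qed.

Lemma Eind_sym t A x y : Eind t A x y = Eind t A y x.
Proof. induction A as [|A IH]; simpl; [reflexivity|]. now rewrite IH, (Nat.eqb_sym (x A)). Qed.

Lemma cis_sum_full A x y :
  G x -> G y ->
  Cmod (sumC (m A) (fun u => cis (INR u * theta A x y)))
  = INR (m A) * (if Nat.eqb (x A) (y A) then 1 else 0).
Proof.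
  intros Hx Hy. unfold theta. rewrite root_of_unity_sum by (apply Hx || apply Hy).
  destruct (Nat.eqb (x A) (y A)); [|rewrite Cmod_C0; ring].
  unfold Cmod; simpl.
  replace (INR (m A) * (INR (m A) * 1) + 0 * (0 * 1)) with (INR (m A) * INR (m A)) by ring.
  rewrite sqrt_square by apply pos_INR. ring.
Qed.

Lemma cis_sum_le q t : Cmod (sumC q (fun u => cis (INR u * t))) <= INR q.
Proof.
  eapply Rle_trans; [apply Cmod_sumC|].
  rewrite (sumR_ext _ _ (fun _ => 1)) by (intros; apply Cmod_cis).
  rewrite sumR_const. lra.
Qed.

(** The Paley identity, in modulus: D_{M_{A+1}} is D_{M_A} times a full sum of roots of unity, which
    is m_A or 0 according to whether the coordinates at [A] agree. *)
Lemma Dker_Mk A x y : G x -> G y -> Cmod (Dker (Mk m A) x y) = M A * Eind A A x y.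
Proof.
  intros Hx Hy. induction A as [|A IH].
  - unfold Dker. simpl. replace (Cadd C0 (wker 0 x y)) with (wker 0 x y) by cx.
    unfold wker. rewrite Cmod_cis. ring.
  - change (Mk m (S A)) with (m A * Mk m A)%nat at 1. rewrite Dker_mult by lia. rewrite Cmod_mul, cis_sum_full, IH by assumption.
    rewrite Mk_S. cbn [Eind]. rewrite (Eind_outside (S A) A) by lia.
    destruct (Nat.eqb_spec A (S A)); [lia|]. ring.
Qed.

Lemma Dker_mult_le q A x y :
  G x -> G y -> (q <= m A)%nat ->
  Cmod (Dker (q * Mk m A) x y) <= INR K * (M A * Eind A A x y).
Proof.
  intros Hx Hy Hq. rewrite Dker_mult, Cmod_mul, Dker_Mk by assumption.
  apply Rmult_le_compat_r.
  - pose proof (Mk_ge1 A). pose proof (Eind_nonneg A A x y). nra.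
  - eapply Rle_trans; [apply cis_sum_le|]. apply le_INR. pose proof (HK A). lia.
Qed.

Lemma sum_Dker_mult_le q A x y :
  G x -> G y -> (q <= m A)%nat ->
  Cmod (Cscale (M A) (sumC q (fun u => Dker (u * Mk m A) x y)))
  <= INR K ^ 2 * (M A * M A * Eind A A x y).
Proof.
  intros Hx Hy Hq. pose proof (Mk_ge1 A). pose proof (Eind_nonneg A A x y).
  assert (INR q <= INR K) by (apply le_INR; pose proof (HK A); lia).
  pose proof K_ge2. pose proof (pos_INR q).
  rewrite Cmod_scale by lra.
  assert (Cmod (sumC q (fun u => Dker (u * Mk m A) x y)) <= INR q * (INR K * (M A * Eind A A x y))).
  { eapply Rle_trans; [apply Cmod_sumC|]. rewrite <- sumR_const. apply sumR_le.
    intros u Hu. apply Dker_mult_le; auto. lia. }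
  assert (INR q * (INR K * (M A * Eind A A x y)) <= INR K * (INR K * (M A * Eind A A x y))).
  { apply Rmult_le_compat_r; [|assumption]. apply Rmult_le_pos; nra. }
  replace (INR K ^ 2 * (M A * M A * Eind A A x y))
    with (M A * (INR K * (INR K * (M A * Eind A A x y)))) by ring.
  apply Rmult_le_compat_l; lra.
Qed.

(** From [A] to [S A] the full sum of roots of unity multiplies the old terms by m_A and by the
    indicator of agreement at [A], turning M_A E_{t,A} into M_{A+1} E_{t,A+1}. The Dirichlet part
    supplies the new term t = A, so the constant does not grow. *)
Lemma Lker_Mk A x y :
  G x -> G y ->
  Cmod (Lker (Mk m A) x y) <= INR K ^ 2 * sumR A (fun t => M t * M A * Eind t A x y).
Proof.
  intros Hx Hy. induction A as [|A IH].
  - unfold Lker. simpl. unfold Dker; simpl. replace (Cadd C0 C0) with C0 by cx.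
    rewrite Cmod_C0. lra.
  - change (Mk m (S A)) with (m A * Mk m A)%nat at 1. rewrite Lker_mult by lia.
    eapply Rle_trans; [apply Cmod_add|].
    pose proof (sum_Dker_mult_le (m A) A x y Hx Hy (le_n _)) as HD.
    rewrite Cmod_mul, cis_sum_full by assumption.
    cbn [sumR]. rewrite Rmult_plus_distr_l, (Rplus_comm (_ * sumR _ _)).
    pose proof (Mk_ge1 A). pose proof (INR_m_ge2 A). pose proof (Eind_nonneg A A x y).
    apply Rplus_le_compat.
    (* Coordinate [A] is exempt in E_{A,A+1}, which therefore equals E_{A,A}. *)
    + eapply Rle_trans; [exact HD|]. cbn [Eind]. rewrite Nat.eqb_refl, Mk_S.
      apply Rmult_le_compat_l; [pose proof K_ge2; nra|].
      rewrite Rmult_1_r. apply Rmult_le_compat_r; [assumption|]. nra.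
    + rewrite (sumR_ext A _ (fun t => INR (m A) * (if Nat.eqb (x A) (y A) then 1 else 0)
                 * (M t * M A * Eind t A x y))).
      * rewrite sumR_scal.
        set (c := INR (m A) * (if Nat.eqb (x A) (y A) then 1 else 0)).
        assert (0 <= c) by (unfold c; destruct (Nat.eqb (x A) (y A)); lra).
        rewrite <- Rmult_assoc, (Rmult_comm (_ ^ 2) c), Rmult_assoc.
        now apply Rmult_le_compat_l.
      * intros t Ht. cbn [Eind]. rewrite Mk_S.
        destruct (Nat.eqb_spec A t); [lia|]. ring.
Qed.

(* The sum has [t <= A]: the term [t = A] accounts for the Dirichlet kernel of order [Mk m A]. *)
Definition Qker A x y : R := sumR (S A) (fun t => M t * M A * Eind t A x y).

Lemma Qker_nonneg A x y : 0 <= Qker A x y.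
Proof.
  apply sumR_nonneg. intros t _. pose proof (Mk_ge1 A). pose proof (Mk_ge1 t).
  apply Rmult_le_pos; [nra|apply Eind_nonneg].
Qed.

(** Leading digits, possibly zero, are removed one at a time: at level B the block recursion leaves
    L_{n mod M_B} times a unimodular factor, and all the rest is absorbed in Q_B. *)
Lemma Lker_le A n x y :
  G x -> G y -> (n < Mk m (S A))%nat ->
  Cmod (Lker n x y) <= 2 * INR K ^ 3 * sumR (S A) (fun A' => Qker A' x y).
Proof.
  intros Hx Hy. 
  assert (Hstep : forall B n, (n < Mk m (S B))%nat ->
    Cmod (Lker n x y) <= 2 * INR K ^ 3 * Qker B x y + Cmod (Lker (n mod Mk m B) x y)).
  { clear n. intros B n Hn. pose proof (Mk_pos B) as HB.
    set (q := (n / Mk m B)%nat). set (s := (n mod Mk m B)%nat).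
    assert (Hnq : n = (q * Mk m B + s)%nat).
    { unfold q, s. rewrite Nat.mul_comm. apply Nat.div_mod. lia. }
    assert (Hs : (s < Mk m B)%nat) by (apply Nat.mod_upper_bound; lia).
    assert (Hq : (q < m B)%nat) by (simpl in Hn; nia).
    rewrite Hnq at 1. rewrite Lker_block by lia.
    rewrite Lker_mult by lia.
    pose proof (sum_Dker_mult_le q B x y Hx Hy ltac:(lia)) as H1.
    pose proof (Dker_mult_le q B x y Hx Hy ltac:(lia)) as H2.
    pose proof (Lker_Mk B x y Hx Hy) as H3.
    pose proof (cis_sum_le q (theta B x y)) as H4.
    assert (HqK : INR q <= INR K) by (apply le_INR; pose proof (HK B); lia).
    assert (HsM : INR s <= M B) by (apply le_INR; lia).
    pose proof (pos_INR s). pose proof (pos_INR q). pose proof (Mk_ge1 B). pose proof K_ge2.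
    pose proof (Eind_nonneg B B x y).
    set (S0 := sumR B (fun t => M t * M B * Eind t B x y)) in *.
    assert (HS0 : 0 <= S0).
    { apply sumR_nonneg. intros t _. pose proof (Mk_ge1 t).
      apply Rmult_le_pos; [nra|apply Eind_nonneg]. }
    set (e := M B * M B * Eind B B x y) in *.
    assert (He : 0 <= e) by (unfold e; apply Rmult_le_pos; nra).
    (* [S0] collects the terms t < B, coming from L_{M_B}; [e] is the term t = B, coming from the
       Dirichlet kernels. *)
    assert (HQ : Qker B x y = S0 + e) by reflexivity.
    eapply Rle_trans; [apply Cmod_add|].
    eapply Rle_trans; [apply Rplus_le_compat; apply Cmod_add|].
    rewrite !Cmod_mul, Cmod_cis, Rmult_1_l, (Cmod_scale (INR s)) by assumption.
    assert (Hb5 : INR s * Cmod (Dker (q * Mk m B) x y) <= INR K * e).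
    { eapply Rle_trans.
      - apply Rmult_le_compat; [assumption|apply Cmod_ge0|exact HsM|exact H2].
      - unfold e. right. ring. }
    assert (Hb6 : Cmod (sumC q (fun u => cis (INR u * theta B x y))) * Cmod (Lker (Mk m B) x y)
                 <= INR K * (INR K ^ 2 * S0)).
    { apply Rmult_le_compat; [apply Cmod_ge0|apply Cmod_ge0|lra|exact H3]. }
    rewrite HQ.
    assert (INR K * e <= INR K ^ 3 * e) by (apply Rmult_le_compat_r; [assumption|simpl; nra]).
    assert (INR K ^ 2 * e <= INR K ^ 3 * e) by (apply Rmult_le_compat_r; [assumption|simpl; nra]).
    assert (0 <= INR K ^ 3 * S0) by (apply Rmult_le_pos; [simpl; nra|assumption]).
    replace (INR K * (INR K ^ 2 * S0)) with (INR K ^ 3 * S0) in Hb6 by ring.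
    replace (2 * INR K ^ 3 * (S0 + e)) with (2 * (INR K ^ 3 * S0) + 2 * (INR K ^ 3 * e)) by ring.
    lra. }
  revert n. induction A as [|A IH]; intros n Hn.
  - eapply Rle_trans; [exact (Hstep _ _ Hn)|]. simpl Mk. rewrite Nat.mod_1_r.
    unfold Lker at 1; simpl sumC. rewrite Cmod_C0. simpl sumR. lra.
  - eapply Rle_trans; [exact (Hstep _ _ Hn)|].
    specialize (IH (n mod Mk m (S A))%nat).
    assert (Hlt : (n mod Mk m (S A) < Mk m (S A))%nat)
      by (apply Nat.mod_upper_bound; pose proof (Mk_pos (S A)); lia).
    specialize (IH Hlt). cbn [sumR] in *. rewrite Rmult_plus_distr_l. lra.
Qed.

(** * Averages of the kernels over cells *)

(** Each coordinate k in [a, A) forced to agree contributes 1 / m_k and an exempt one contributes 1;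
    the product is M_a / M_A, times m_t when t lies in that range. *)
Lemma avg_Eind t A a r x y :
  G x -> G y -> (a <= A <= a + r)%nat ->
  avg_from m a r (Eind t A x) y * M A
  = M a * Eind t a x y * (if andb (Nat.leb a t) (Nat.ltb t A) then INR (m t) else 1).
Proof.
  intros Hx. revert a y. induction r as [|r IH]; intros a y Hy HA.
  - replace A with a by lia. simpl.
    destruct (Nat.leb_spec a t), (Nat.ltb_spec t a); try lia; simpl; ring.
  - destruct (Nat.eq_dec a A) as [<-|Hne].
    + rewrite avg_dep_id by (auto; now apply Eind_dep).
      destruct (Nat.leb_spec a t), (Nat.ltb_spec t a); try lia; simpl; ring.
    + cbn [avg_from]. rewrite Rmult_assoc, (Rmult_comm (sumR _ _)), <- sumR_scal.
      rewrite (sumR_ext _ _ (fun b => (M (S a) * Eind t a x y *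
          (if andb (Nat.leb (S a) t) (Nat.ltb t A) then INR (m t) else 1)) *
          (if Nat.eqb a t then 1 else if Nat.eqb (x a) b then 1 else 0))).
      * rewrite sumR_scal, Mk_S. pose proof (INR_m_ge2 a).
        destruct (Nat.eqb_spec a t) as [<-|Hat].
        -- rewrite sumR_const.
           destruct (Nat.leb_spec (S a) a), (Nat.leb_spec a a), (Nat.ltb_spec a A); try lia.
           simpl. field. lra.
        -- rewrite (sumR_indicator (m a) (x a) 1) by apply Hx.
           destruct (Nat.leb_spec (S a) t), (Nat.leb_spec a t), (Nat.ltb_spec t A); try lia;
             simpl; field; lra.
      * intros b Hb. rewrite Rmult_comm, IH by (auto using G_upd; lia).
        cbn [Eind]. rewrite upd_same.
        rewrite (dep_upd a a (Eind t a x)) by (auto; now apply Eind_dep). ring.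
Qed.

Lemma avg_Eind_le t A a r x y :
  G x -> G y -> (a <= A <= a + r)%nat ->
  avg_from m a r (Eind t A x) y * M A <= INR K * (M a * Eind t a x y).
Proof.
  intros Hx Hy H. rewrite avg_Eind by assumption. rewrite Rmult_comm.
  pose proof (Mk_ge1 a). pose proof (Eind_nonneg t a x y). pose proof K_ge2.
  apply Rmult_le_compat_r; [nra|].
  destruct (andb (Nat.leb a t) (Nat.ltb t A)); [apply INR_m_leK|lra].
Qed.

(** Split the sum over t at [a]. The terms t < a give at most M_a Q_a; for t >= a all E_{t,a} equal
    E_{a,a}, and the M_t add up to at most 2 M_A. This makes the 3, while [K] bounds the possible
    factor m_t. *)
Lemma avg_Qker_le A a r x y :
  G x -> G y -> (a <= A <= a + r)%nat ->
  M a * avg_from m a r (Qker A x) y <= 3 * INR K * M A * Qker a x y.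
Proof.
  intros Hx Hy H. pose proof (Mk_ge1 a) as Ha. pose proof (Mk_ge1 A) as HA.
  pose proof K_ge2 as HK2.
  assert (HaA : M a <= M A) by (apply le_INR, Mk_le; lia).
  set (q := Qker a x y).
  assert (Hq : 0 <= q) by apply Qker_nonneg.
  assert (Hterm : forall t, (t <= a)%nat -> M t * M a * Eind t a x y <= q).
  { intros t Ht. unfold q, Qker.
    apply (sumR_term_le (S a) (fun t => M t * M a * Eind t a x y)); [|lia].
    intros j _. pose proof (Mk_ge1 j). pose proof (Eind_nonneg j a x y).
    apply Rmult_le_pos; nra. }
  unfold Qker at 1.
  rewrite (avg_sumR a r (S A) (fun t y => M t * M A * Eind t A x y)).
  apply Rle_trans with (M a * (INR K * sumR (S A) (fun t => M t * (M a * Eind t a x y)))).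
  - apply Rmult_le_compat_l; [lra|]. rewrite <- sumR_scal. apply sumR_le.
    intros t _. rewrite avg_scal.
    pose proof (avg_Eind_le t A a r x y Hx Hy H). pose proof (Mk_ge1 t).
    replace (M t * M A * avg_from m a r (Eind t A x) y)
      with (M t * (avg_from m a r (Eind t A x) y * M A)) by ring.
    replace (INR K * (M t * (M a * Eind t a x y)))
      with (M t * (INR K * (M a * Eind t a x y))) by ring.
    apply Rmult_le_compat_l; lra.
  - assert (Hsum : sumR (S A) (fun t => M t * (M a * (M a * Eind t a x y))) <= 3 * M A * q).
    { replace (S A) with (a + (S A - a))%nat by lia. rewrite sumR_add.
      assert (H1 : sumR a (fun t => M t * (M a * (M a * Eind t a x y))) <= M a * q).
      { rewrite (sumR_ext a _ (fun t => M a * (M t * M a * Eind t a x y))) by (intros; ring).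
        rewrite sumR_scal. apply Rmult_le_compat_l; [lra|].
        unfold q, Qker. apply sumR_widen; [lia|]. intros j _.
        pose proof (Mk_ge1 j). pose proof (Eind_nonneg j a x y). apply Rmult_le_pos; nra. }
      assert (H2 : sumR (S A - a) (fun i => M (a + i) * (M a * (M a * Eind (a + i) a x y)))
                   <= 2 * M A * q).
      { rewrite (sumR_ext _ _ (fun i => (M a * M a * Eind a a x y) * M (a + i))).
        - rewrite sumR_scal.
          assert (Hs : sumR (S A - a) (fun i => M (a + i)) <= 2 * M A).
          { apply Rle_trans with (sumR (S A) (fun t => M t)).
            - replace (S A) with (a + (S A - a))%nat at 2 by lia. rewrite sumR_add.
              pose proof (sumR_nonneg a (fun t => M t) ltac:(intros; apply pos_INR)). lra.
            - cbn [sumR]. pose proof (sum_Mk_le A). lra. }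
          specialize (Hterm a (le_n _)). rewrite Rmult_comm.
          apply Rmult_le_compat; auto.
          + apply sumR_nonneg. intros; apply pos_INR.
          + apply Rmult_le_pos; [nra|apply Eind_nonneg].
        - intros i _. rewrite (Eind_outside (a + i) a) by lia. ring. }
      nra. }
    rewrite (sumR_ext _ _ (fun t => M a * (M t * (M a * Eind t a x y)))) in Hsum by (intros; ring).
    rewrite sumR_scal in Hsum.
    replace (M a * (INR K * sumR (S A) (fun t => M t * (M a * Eind t a x y))))
      with (INR K * (M a * sumR (S A) (fun t => M t * (M a * Eind t a x y)))) by ring.
    replace (3 * INR K * M A * q) with (INR K * (3 * M A * q)) by ring.
    apply Rmult_le_compat_l; lra.
Qed.

(** * Fejer means as integral operators *)

Notation zero := (fun _ : nat => 0%nat).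

Definition Sig N n (g : point -> Cx) x : Cx :=
  Cscale (/ INR n) (Cavg 0 N (fun y => Cmul (g y) (Lker n x y)) zero).

Lemma martingale_cond f k r y :
  martingale m f -> G y -> Cavg k r (f (k + r)%nat) y = f k y.
Proof.
  intros [_ Hf]. revert k y. induction r as [|r IH]; intros k y Hy.
  - rewrite Nat.add_0_r. unfold Cavg; simpl. now destruct (f k y).
  - rewrite Cavg_S, (Hf k y Hy). f_equal. apply sumC_ext. intros a Ha.
    rewrite <- IH by auto using G_upd. now rewrite Nat.add_succ_r.
Qed.

Lemma psi_dep j : dep (S j) (psi m j).
Proof.
  intros x y Hx Hy Hxy. unfold psi.
  rewrite (sumR_ext (S j) (fun k => INR (digit m j k * x k) / INR (m k))
             (fun k => INR (digit m j k * y k) / INR (m k))); [reflexivity|].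
  intros k Hk. now rewrite Hxy.
Qed.

(** Averaging first over the cells of level j + 1, psi_j passes through and the martingale property
    turns f^(N) into f^(j+1). *)
Lemma fourier_level f j N :
  martingale m f -> (S j <= N)%nat ->
  fourier m f j = Cavg 0 N (fun y => Cmul (f N y) (Cconj (psi m j y))) zero.
Proof.
  intros Hf HN. pose proof G_zero. rewrite (Cavg_split (S j) N) by assumption.
  change (fourier m f j) with (Cavg 0 (S j) (fun y => Cmul (f (S j) y) (Cconj (psi m j y))) zero).
  apply Cavg_ext; auto. intros y Hy.
  rewrite (Cavg_ext _ _ _ (fun y => Cmul (Cconj (psi m j y)) (f N y))) by (auto; intros; cx).
  rewrite (Cavg_mul_dep (S j) _ (fun y => Cconj (psi m j y))); auto.
  - replace (f N) with (f (S j + (N - S j))%nat) by (f_equal; lia).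
    rewrite martingale_cond by assumption. cx.
  - intros u v Hu Hv Huv. f_equal. now apply psi_dep.
Qed.

(** For [n <= N] every coefficient involved can be computed from f^(N) alone, so the Fejer mean
    becomes a linear operator on single functions, to which a decomposition of f^(N) applies. *)
Lemma fejer_Sig f n N x :
  martingale m f -> (n <= N)%nat -> fejer m f n x = Sig N n (f N) x.
Proof.
  intros Hf Hn. unfold fejer, Sig. f_equal. pose proof G_zero.
  rewrite (Cavg_ext _ _ _ (fun y => sumC n (fun k => sumC k (fun j => Cmul (f N y) (wker j x y))))).
  - rewrite (Cavg_sumC 0 N n (fun k y => sumC k (fun j => Cmul (f N y) (wker j x y)))).
    apply sumC_ext. intros k Hk. unfold Spart.
    rewrite (Cavg_sumC 0 N k (fun j y => Cmul (f N y) (wker j x y))).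
    apply sumC_ext. intros j Hj. rewrite (fourier_level f j N) by (auto; lia).
    transitivity (Cmul (psi m j x) (Cavg 0 N (fun y => Cmul (f N y) (Cconj (psi m j y))) zero)); [cx|].
    rewrite <- Cavg_mul by assumption. apply Cavg_ext; auto.
    intros y _. rewrite <- psi_mul_conj. cx.
  - assumption.
  - intros y _. unfold Lker. rewrite Cmul_sumC. apply sumC_ext. intros k _.
    unfold Dker. now rewrite Cmul_sumC.
Qed.

Lemma Sig_add N n g h x :
  Sig N n (fun y => Cadd (g y) (h y)) x = Cadd (Sig N n g x) (Sig N n h x).
Proof.
  unfold Sig. rewrite (Cavg_ext _ _ _ (fun y => Cadd (Cmul (g y) (Lker n x y)) (Cmul (h y) (Lker n x y))))
    by (auto using G_zero; intros; cx).
  rewrite Cavg_add. cx.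
Qed.

Lemma Sig_ext N n g h x :
  (forall y, G y -> g y = h y) -> Sig N n g x = Sig N n h x.
Proof.
  intros H. unfold Sig. f_equal. apply Cavg_ext; [apply G_zero|]. intros y Hy. now rewrite H.
Qed.

(** For n <= M_a the kernel is F_a-measurable in the integration variable, so it leaves the inner
    average and meets a vanishing conditional mean. *)
Lemma Sig_cancel N n a g x :
  (a <= N)%nat -> (n <= Mk m a)%nat ->
  (forall y, G y -> Cavg a (N - a) g y = C0) -> Sig N n g x = C0.
Proof.
  intros Ha Hn Hg. unfold Sig. rewrite (Cavg_split a N) by assumption.
  rewrite (Cavg_ext _ _ _ (fun _ => C0)).
  - rewrite Cavg_C0. cx.
  - apply G_zero.
  - intros y Hy.
    rewrite (Cavg_ext _ _ _ (fun y => Cmul (Lker n x y) (g y))) by (auto; intros; cx).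
    rewrite Cavg_mul_dep by (auto; now apply Lker_dep). rewrite Hg by assumption. cx.
Qed.

Lemma Mk_bracket n : (1 <= n)%nat -> exists B, (Mk m B <= n < Mk m (S B))%nat.
Proof.
  intros Hn.
  assert (H : forall C, (n < Mk m C)%nat -> exists B, (Mk m B <= n < Mk m (S B))%nat).
  { induction C as [|C IH]; intros HC; [simpl in HC; lia|].
    destruct (le_lt_dec (Mk m C) n); [now exists C|auto]. }
  apply (H n), Mk_gt_id.
Qed.

(** The factor 2 K^3 is that of the pointwise kernel bound; 1 + 6 K comes from collapsing the terms
    above level a. *)
Definition C1 : R := 2 * INR K ^ 3 * (1 + 6 * INR K).

Lemma C1_nonneg : 0 <= C1.
Proof. pose proof K_ge2. unfold C1. simpl. repeat apply Rmult_le_pos; lra. Qed.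

(** With M_B <= n < M_{B+1}, the terms A' > a collapse to level a with weights of order M_{A'} /
    M_a, whose sum is at most 2 M_B / M_a. Division by n >= M_B leaves the rate 1 / M_a. *)
Lemma Sig_le N n a lam (A : point -> R) g x :
  (a <= N)%nat -> 0 <= lam -> dep a A -> (forall y, G y -> 0 <= A y) ->
  (forall y, G y -> Cmod (g y) <= lam * A y) ->
  (1 <= n <= N)%nat -> (Mk m a <= n)%nat -> G x ->
  Cmod (Sig N n g x)
  <= lam * C1 * (integral_lvl m N (fun y => A y * sumR (S a) (fun A' => Qker A' x y)) / M a).
Proof.
  intros Ha Hlam HdA HA Hg Hn Han Hx.
  destruct (Mk_bracket n ltac:(lia)) as [B [HB1 HB2]].
  assert (HaB : (a <= B)%nat).
  { destruct (le_lt_dec a B); auto. pose proof (Mk_le (S B) a ltac:(lia)). lia. }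
  (* As M_N > N >= n, every level in the kernel bound lies within the range averaged over. *)
  assert (HBN : (B <= N)%nat).
  { destruct (le_lt_dec B N); auto. pose proof (Mk_le N B ltac:(lia)).
    pose proof (Mk_gt_id N). lia. }
  pose proof K_ge2 as HK2. pose proof (Mk_ge1 a) as HMa. pose proof G_zero as Hz.
  assert (HnB : M B <= INR n) by (apply le_INR; lia).
  pose proof (Mk_ge1 B) as HMB.
  unfold Sig. rewrite Cmod_scale by (left; apply Rinv_0_lt_compat; lra).
  set (J := fun A' => integral_lvl m N (fun y => A y * Qker A' x y)).
  assert (HJ0 : forall A', 0 <= J A').
  { intros A'. apply avg_nonneg; auto. intros y Hy. apply Rmult_le_pos; auto using Qker_nonneg. }
  assert (HJ : forall p, integral_lvl m N (fun y => A y * sumR p (fun A' => Qker A' x y)) = sumR p J).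
  { intros p. unfold integral_lvl.
    rewrite (avg_ext _ _ _ (fun y => sumR p (fun A' => A y * Qker A' x y)))
      by (auto; intros; now rewrite sumR_scal).
    apply (avg_sumR 0 N p (fun A' y => A y * Qker A' x y)). }
  assert (H1 : Cmod (Cavg 0 N (fun y => Cmul (g y) (Lker n x y)) zero)
               <= lam * (2 * INR K ^ 3) * sumR (S B) J).
  { eapply Rle_trans; [now apply Cmod_Cavg|].
    rewrite <- HJ. unfold integral_lvl. rewrite <- avg_scal. apply avg_le; auto.
    intros y Hy. rewrite Cmod_mul.
    replace (lam * (2 * INR K ^ 3) * (A y * sumR (S B) (fun A' => Qker A' x y)))
      with (lam * A y * (2 * INR K ^ 3 * sumR (S B) (fun A' => Qker A' x y))) by ring.
    apply Rmult_le_compat; auto using Cmod_ge0. now apply Lker_le. }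
  (* Both [A] and Q_a are F_a-measurable, so the average over a cell of level a acts on Q_{A'}
     only. *)
  assert (H2 : forall A', (a <= A' <= B)%nat -> M a * J A' <= 3 * INR K * M A' * J a).
  { intros A' HA'. unfold J, integral_lvl. rewrite <- !avg_scal.
    rewrite !(avg_split a N) by assumption. apply avg_le; auto. intros y Hy.
    rewrite (avg_ext _ _ _ (fun y => M a * A y * Qker A' x y)) by (auto; intros; ring).
    rewrite (avg_mul_dep a _ (fun y => M a * A y)); auto.
    2:{ intros u v Hu Hv Huv. now rewrite (HdA u v). }
    rewrite (avg_dep_id a _ (fun y => 3 * INR K * M A' * (A y * Qker a x y))); auto.
    2:{ intros u v Hu Hv Huv. rewrite (HdA u v) by assumption. do 2 f_equal.
        unfold Qker. apply sumR_ext. intros t _.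
        now rewrite (Eind_dep t a a x (le_n _) u v). }
    pose proof (avg_Qker_le A' a (N - a) x y Hx Hy ltac:(lia)).
    change (fun x0 => Qker A' x x0) with (Qker A' x).
    rewrite (Rmult_comm (M a)), Rmult_assoc.
    replace (3 * INR K * M A' * (A y * Qker a x y))
      with (A y * (3 * INR K * M A' * Qker a x y)) by ring.
    apply Rmult_le_compat_l; auto. }
  (* The 1 is for the levels up to a, via M_a <= M_B; 6 K is 3 K times the 2 of the geometric
     sum. *)
  assert (H3 : M a * sumR (S B) J <= M B * ((1 + 6 * INR K) * sumR (S a) J)).
  { replace (S B) with (S a + (B - a))%nat by lia. rewrite sumR_add, Rmult_plus_distr_l.
    assert (HMab : M a <= M B) by (apply le_INR, Mk_le; lia).
    pose proof (sumR_nonneg (S a) J ltac:(auto)) as HS.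
    assert (HJa : J a <= sumR (S a) J) by (apply sumR_term_le; auto).
    assert (M a * sumR (B - a) (fun i => J (S a + i)%nat) <= 6 * INR K * M B * J a).
    { rewrite <- sumR_scal.
      apply Rle_trans with (sumR (B - a) (fun i => 3 * INR K * J a * M (S a + i))).
      - apply sumR_le. intros i Hi. pose proof (H2 (S a + i)%nat ltac:(lia)). lra.
      - rewrite sumR_scal.
        assert (sumR (B - a) (fun i => M (S a + i)) <= 2 * M B).
        { apply Rle_trans with (sumR (S B) (fun t => M t)).
          - replace (S B) with (S a + (B - a))%nat by lia. rewrite sumR_add.
            pose proof (sumR_nonneg (S a) (fun t => M t) ltac:(intros; apply pos_INR)). lra.
          - cbn [sumR]. pose proof (sum_Mk_le B). lra. }
        replace (6 * INR K * M B * J a) with (3 * INR K * J a * (2 * M B)) by ring.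
        apply Rmult_le_compat_l; [|assumption].
        apply Rmult_le_pos; [lra|apply HJ0]. }
    assert (6 * INR K * M B * J a <= 6 * INR K * M B * sumR (S a) J)
      by (apply Rmult_le_compat_l; [nra|assumption]).
    assert (M a * sumR (S a) J <= M B * sumR (S a) J) by (apply Rmult_le_compat_r; assumption).
    lra. }
  rewrite HJ. pose proof (sumR_nonneg (S a) J ltac:(auto)) as HS.
  assert (HK3 : 0 <= lam * (2 * INR K ^ 3)) by (apply Rmult_le_pos; [assumption|simpl; nra]).
  apply Rmult_le_reg_l with (INR n * M a); [nra|].
  replace (INR n * M a * (/ INR n * Cmod (Cavg 0 N (fun y => Cmul (g y) (Lker n x y)) zero)))
    with (M a * Cmod (Cavg 0 N (fun y => Cmul (g y) (Lker n x y)) zero)) by (field; lra).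
  replace (INR n * M a * (lam * C1 * (sumR (S a) J / M a)))
    with (lam * (2 * INR K ^ 3) * (INR n * ((1 + 6 * INR K) * sumR (S a) J)))
    by (unfold C1; field; lra).
  apply Rle_trans with (lam * (2 * INR K ^ 3) * (M a * sumR (S B) J)).
  - replace (lam * (2 * INR K ^ 3) * (M a * sumR (S B) J))
      with (M a * (lam * (2 * INR K ^ 3) * sumR (S B) J)) by ring.
    apply Rmult_le_compat_l; lra.
  - apply Rmult_le_compat_l; [assumption|]. eapply Rle_trans; [exact H3|].
    apply Rmult_le_compat_r; [|assumption]. apply Rmult_le_pos; lra.
Qed.

(** * The maximal operator on atoms *)

(** An indicator is its own square root, so this majorises termwise the square root of the sum of
    the Q_A with A <= a. *)
Definition Rker a x y : R :=
  sumR (S a) (fun A => sumR (S A) (fun t => sqrt (M t * M A) * Eind t A x y)).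

Lemma Rker_nonneg a x y : 0 <= Rker a x y.
Proof.
  apply sumR_nonneg. intros A _. apply sumR_nonneg. intros t _.
  apply Rmult_le_pos; [apply sqrt_pos|apply Eind_nonneg].
Qed.

(** Consecutive terms have ratio at least 2^{1/2} > 4/3, which closes the induction as 3 + 1 = 4. *)
Lemma sum_sqrt_Mk_le A : sumR A (fun t => sqrt (M t)) <= 3 * sqrt (M A).
Proof.
  induction A as [|A IH]; [simpl; rewrite sqrt_1; lra|]. cbn [sumR].
  pose proof (sqrt_pos (M A)). pose proof (sqrt_pos (M (S A))).
  assert (4 * sqrt (M A) <= 3 * sqrt (M (S A))); [|lra].
  pose proof (Mk_ge1 A). pose proof (Mk_ge1 (S A)). pose proof (INR_m_ge2 A).
  apply Rsqr_incr_0_var; [|lra]. rewrite !Rsqr_mult, !Rsqr_sqrt by lra.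
  rewrite Mk_S. unfold Rsqr. nra.
Qed.

(** The integral of E_{t,A} is at most K / M_A, so each term gives at most K (M_t / M_A)^{1/2}. Over
    t <= A these add up to 4 K at most (3 from t < A, 1 from t = A), for each of the a + 1 values of
    A. *)
Lemma Rker_integral N a y :
  G y -> (a <= N)%nat ->
  integral_lvl m N (fun x => Rker a x y) <= INR (S a) * (4 * INR K).
Proof.
  intros Hy Ha. unfold integral_lvl, Rker. pose proof G_zero as Hz.
  rewrite (avg_sumR 0 N (S a)
    (fun A x => sumR (S A) (fun t => sqrt (M t * M A) * Eind t A x y))).
  rewrite <- sumR_const. apply sumR_le. intros A HA.
  rewrite (avg_sumR 0 N (S A) (fun t x => sqrt (M t * M A) * Eind t A x y)).
  pose proof (Mk_ge1 A) as HMA. pose proof K_ge2.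
  assert (Hs : 0 < sqrt (M A)) by (apply sqrt_lt_R0; lra).
  pose proof (sqrt_sqrt (M A) ltac:(lra)) as Hss.
  apply Rle_trans with (sumR (S A) (fun t => INR K / sqrt (M A) * sqrt (M t))).
  - apply sumR_le. intros t _. rewrite avg_scal.
    (* The average bound for [Eind] concerns its second point, the present integral its first. *)
    rewrite (avg_ext _ _ _ (Eind t A y)) by (auto; intros; apply Eind_sym).
    pose proof (avg_Eind_le t A 0 N y _ Hy Hz ltac:(lia)) as H1.
    simpl (M 0 * Eind t 0 y _) in H1.
    rewrite sqrt_mult by apply pos_INR.
    set (v := avg_from m 0 N (Eind t A y) zero) in *.
    rewrite Rmult_comm. replace (v * (sqrt (M t) * sqrt (M A)))
      with (v * (sqrt (M A) * sqrt (M A)) / sqrt (M A) * sqrt (M t)) by (field; lra).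
    rewrite Hss.
    apply Rmult_le_compat_r; [apply sqrt_pos|].
    unfold Rdiv. apply Rmult_le_compat_r; [left; now apply Rinv_0_lt_compat|]. lra.
  - rewrite sumR_scal. cbn [sumR]. pose proof (sum_sqrt_Mk_le A).
    apply Rle_trans with (INR K / sqrt (M A) * (4 * sqrt (M A))).
    + apply Rmult_le_compat_l; [|lra]. apply Rmult_le_pos; [lra|].
      left. now apply Rinv_0_lt_compat.
    + right. field. lra.
Qed.

Lemma sqrt_scaled_indicator c e : 0 <= c -> e = 0 \/ e = 1 -> sqrt (c * e) = sqrt c * e.
Proof.
  intros Hc [-> | ->]; rewrite ?Rmult_0_r, ?Rmult_1_r; [apply sqrt_0|reflexivity].
Qed.

Lemma sqrt_sum_Qker_le a x y :
  sqrt (sumR (S a) (fun A => Qker A x y)) <= Rker a x y.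
Proof.
  eapply Rle_trans; [apply sqrt_sumR_le; intros; apply Qker_nonneg|].
  apply sumR_le. intros A _. unfold Qker.
  eapply Rle_trans; [apply sqrt_sumR_le|].
  - intros t _. apply Rmult_le_pos; [|apply Eind_nonneg].
    apply Rmult_le_pos; apply pos_INR.
  - apply sumR_le. intros t _. right. apply sqrt_scaled_indicator; [|apply Eind_01].
    apply Rmult_le_pos; apply pos_INR.
Qed.

(** Since n >= M_a >= 2^a and n >= 1, the logarithm dominates both a ln 2 and ln 2, hence their
    mean. *)
Lemma ln_ge_level n a :
  (1 <= n)%nat -> (Mk m a <= n)%nat -> ln 2 * INR (S a) / 2 <= ln (INR (n + 1)).
Proof.
  intros Hn Ha.
  assert (H1 : ln 2 <= ln (INR (n + 1))).
  { apply Rcomplements.ln_le; [lra|]. apply (le_INR 2). lia. }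
  assert (H2 : INR a * ln 2 <= ln (INR (n + 1))).
  { rewrite <- ln_pow by lra. apply Rcomplements.ln_le; [apply pow_lt; lra|].
    pose proof (Mk_add_ge 0 a) as H. simpl in H.
    apply Rle_trans with (M a); [lra|]. apply le_INR. lia. }
  rewrite S_INR. lra.
Qed.

(* [w] bounds the L_{1/2} size (before squaring) of the maximal operator at [g]. *)
Definition max_bound N (g : point -> Cx) (w : R) : Prop :=
  exists W : point -> R,
    (forall x, G x -> 0 <= W x) /\
    (forall x n, G x -> (1 <= n <= N)%nat ->
       sqrt (Cmod (Sig N n g x) / ln (INR (n + 1)) ^ 2) <= W x) /\
    integral_lvl m N W <= w.

Lemma ln_succ_pos n : (1 <= n)%nat -> 0 < ln (INR (n + 1)).
Proof.
  intros Hn. rewrite <- ln_1. apply ln_increasing; [lra|]. apply (lt_INR 1). lia.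
Qed.

(** Subadditivity of the square root makes the bounds additive; this is why sizes are measured
    before squaring. *)
Lemma max_bound_add N g h v w :
  max_bound N g v -> max_bound N h w -> max_bound N (fun y => Cadd (g y) (h y)) (v + w).
Proof.
  intros [V [HV0 [HV HVi]]] [W [HW0 [HW HWi]]].
  exists (fun x => V x + W x). split; [|split].
  - intros x Hx. specialize (HV0 x Hx). specialize (HW0 x Hx). lra.
  - intros x n Hx Hn. specialize (HV x n Hx Hn). specialize (HW x n Hx Hn).
    pose proof (ln_succ_pos n ltac:(lia)) as Hl.
    assert (Hp : 0 < / ln (INR (n + 1)) ^ 2) by (apply Rinv_0_lt_compat, pow_lt, Hl).
    eapply Rle_trans; [|apply Rplus_le_compat; [exact HV|exact HW]].
    eapply Rle_trans; [apply sqrt_le_1_alt|apply sqrt_sum_le].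
    + rewrite Sig_add. unfold Rdiv. rewrite <- Rmult_plus_distr_r.
      apply Rmult_le_compat_r; [lra|apply Cmod_add].
    + apply Rmult_le_pos; [apply Cmod_ge0|lra].
    + apply Rmult_le_pos; [apply Cmod_ge0|lra].
  - unfold integral_lvl in *. rewrite avg_plus. lra.
Qed.

Lemma max_bound_ext N g h w :
  (forall y, G y -> g y = h y) -> max_bound N g w -> max_bound N h w.
Proof.
  intros H [W [HW0 [HW HWi]]]. exists W. split; [assumption|split; [|assumption]].
  intros x n Hx Hn. rewrite <- (Sig_ext N n g h x H). auto.
Qed.

Lemma max_bound_le N g v w : v <= w -> max_bound N g v -> max_bound N g w.
Proof. intros H [W [HW0 [HW HWi]]]. exists W. repeat split; auto. lra. Qed.

(** 8 K / ln 2 is the 4 K of the integrated kernel times the 2 / ln 2 of the logarithmic bound. *)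
Definition C2 : R := sqrt C1 * (8 * INR K / ln 2).

(** Under the root the weight is 1 / log (n + 1), at most 2 / (ln 2 (a + 1)) for n >= M_a; this
    cancels the a + 1 of the integrated kernel and makes the bound uniform in [a]. The alternative
    [a = 0] admits atoms without mean zero, since n >= 1 = M_0 always. *)
Lemma max_bound_atom N a lam (A : point -> R) g :
  (a <= N)%nat -> 0 <= lam -> dep a A -> (forall y, G y -> A y = 0 \/ A y = 1) ->
  (forall y, G y -> Cmod (g y) <= lam * A y) ->
  (a = 0%nat \/ forall y, G y -> Cavg a (N - a) g y = C0) ->
  max_bound N g (C2 * sqrt lam * integral_lvl m N A).
Proof.
  intros Ha Hlam HdA HA Hg Hcancel. pose proof G_zero as Hz.
  assert (HA0 : forall y, G y -> 0 <= A y) by (intros y Hy; destruct (HA y Hy); lra).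
  pose proof C1_nonneg as HC1. pose proof ln_lt_2 as Hln2.
  assert (HSa : 0 < INR (S a)) by (apply lt_0_INR; lia).
  set (c := sqrt (lam * C1) * (2 / (ln 2 * INR (S a)))).
  assert (Hd0 : 0 < 2 / (ln 2 * INR (S a))) by (apply Rdiv_lt_0_compat; nra).
  assert (Hc : 0 <= c) by (apply Rmult_le_pos; [apply sqrt_pos|lra]).
  assert (HI0 : forall x, 0 <= integral_lvl m N (fun y => A y * Rker a x y)).
  { intros x. apply avg_nonneg; auto. intros y Hy. apply Rmult_le_pos; auto using Rker_nonneg. }
  exists (fun x => c * integral_lvl m N (fun y => A y * Rker a x y)).
  split; [|split].
  - intros x _. now apply Rmult_le_pos.
  - intros x n Hx Hn. destruct (le_lt_dec (Mk m a) n) as [Han|Han].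
    + pose proof (ln_ge_level n a ltac:(lia) Han) as Hl.
      pose proof (ln_succ_pos n ltac:(lia)) as Hl0.
      pose proof (Mk_ge1 a) as HMa.
      pose proof (Sig_le N n a lam A g x Ha Hlam HdA HA0 Hg Hn Han Hx) as HS.
      set (h := fun y => A y * sumR (S a) (fun A' => Qker A' x y)) in *.
      assert (Hh0 : forall y, G y -> 0 <= h y).
      { intros y Hy. apply Rmult_le_pos; auto. apply sumR_nonneg. intros; apply Qker_nonneg. }
      assert (Hhd : dep a h).
      { intros u v Hu Hv Huv. unfold h. rewrite (HdA u v) by assumption. f_equal.
        apply sumR_ext. intros A' HA'. unfold Qker. apply sumR_ext. intros t _.
        now rewrite (Eind_dep t A' a x ltac:(lia) u v). }
      assert (Hsq : sqrt (integral_lvl m N h / M a) <= integral_lvl m N (fun y => A y * Rker a x y)).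
      { pose proof (sqrt_integral_dep_le a N h Ha Hhd Hh0) as Hq.
        assert (Hsm : 0 < sqrt (M a)) by (apply sqrt_lt_R0; lra).
        rewrite sqrt_div_alt by lra.
        apply Rmult_le_reg_l with (sqrt (M a)); [assumption|].
        replace (sqrt (M a) * (sqrt (integral_lvl m N h) / sqrt (M a)))
          with (sqrt (integral_lvl m N h)) by (field; lra).
        eapply Rle_trans; [exact Hq|]. apply Rmult_le_compat_l; [lra|].
        apply avg_le; auto. intros y Hy. unfold h.
        rewrite Rmult_comm, sqrt_scaled_indicator, Rmult_comm; auto.
        - apply Rmult_le_compat_l; auto using sqrt_sum_Qker_le.
        - apply sumR_nonneg. intros; apply Qker_nonneg. }
      rewrite sqrt_div_alt by (apply pow_lt; assumption).
      rewrite sqrt_pow2 by lra.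
      assert (HsX : sqrt (Cmod (Sig N n g x))
                    <= sqrt (lam * C1) * integral_lvl m N (fun y => A y * Rker a x y)).
      { eapply Rle_trans; [apply sqrt_le_1_alt, HS|].
        rewrite sqrt_mult_alt by (apply Rmult_le_pos; assumption).
        apply Rmult_le_compat_l; [apply sqrt_pos|assumption]. }
      unfold c. rewrite Rmult_assoc, (Rmult_comm (2 / _)), <- Rmult_assoc.
      unfold Rdiv at 1. apply Rmult_le_compat; auto using sqrt_pos.
      * left. now apply Rinv_0_lt_compat.
      * replace (2 / (ln 2 * INR (S a))) with (/ (ln 2 * INR (S a) / 2)) by (field; lra).
        apply Rinv_le_contravar; [|assumption]. apply Rdiv_lt_0_compat; nra.
    + destruct Hcancel as [-> | Hcancel]; [simpl in Han; lia|].
      rewrite (Sig_cancel N n a) by (auto; lia).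
      rewrite Cmod_C0. unfold Rdiv. rewrite Rmult_0_l, sqrt_0. now apply Rmult_le_pos.
  - unfold integral_lvl in *. rewrite avg_scal.
    (* After the exchange of integrals, that of the kernel over x is bounded uniformly in y. *)
    rewrite (avg_swap 0 N 0 N (fun x y => A y * Rker a x y)) by assumption.
    assert (H : avg_from m 0 N (fun y => avg_from m 0 N (fun x => A y * Rker a x y) zero) zero
                <= INR (S a) * (4 * INR K) * avg_from m 0 N A zero).
    { rewrite <- avg_scal. apply avg_le; auto. intros y Hy.
      rewrite avg_scal, Rmult_comm. apply Rmult_le_compat_r; auto.
      now apply Rker_integral. }
    eapply Rle_trans; [apply Rmult_le_compat_l; [exact Hc|exact H]|].
    unfold c, C2. rewrite sqrt_mult by assumption. right. field. lra.
Qed.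

Lemma max_bound_zero N g : (forall y, G y -> g y = C0) -> max_bound N g 0.
Proof.
  intros H. apply max_bound_le with (C2 * sqrt 0 * integral_lvl m N (fun _ => 1)).
  - rewrite sqrt_0. lra.
  - apply (max_bound_atom N 0); auto; try lia; try lra.
    + intros x y _ _ _. reflexivity.
    + intros y Hy. rewrite H, Cmod_C0 by assumption. lra.
Qed.

(** * Stopped martingales *)

Fixpoint rmax (p : nat) (h : nat -> R) : R :=
  match p with O => 0 | S p' => Rmax (rmax p' h) (h p') end.

Lemma rmax_ge p h b : (b < p)%nat -> h b <= rmax p h.
Proof.
  induction p as [|p IH]; intros Hb; [lia|]. simpl.
  destruct (Nat.eq_dec b p) as [->|]; [apply Rmax_r|].
  eapply Rle_trans; [apply IH; lia|apply Rmax_l].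
Qed.

Lemma rmax_ext p g h : (forall b, (b < p)%nat -> g b = h b) -> rmax p g = rmax p h.
Proof.
  induction p as [|p IH]; intros H; simpl; [reflexivity|].
  rewrite IH by (intros; apply H; lia). now rewrite H by lia.
Qed.

(** [0 <= s] excludes the starting value 0 of [rmax]. *)
Lemma rmax_attained p h s : 0 <= s -> s < rmax p h -> exists b, (b < p)%nat /\ s < h b.
Proof.
  intros Hs. induction p as [|p IH]; simpl; intros H; [lra|].
  destruct (Rlt_dec s (h p)) as [Hp|Hp]; [exists p; auto|].
  destruct IH as [b [Hb Hsb]]; [|exists b; auto].
  unfold Rmax in H. destruct (Rle_dec (rmax p h) (h p)); lra.
Qed.

Lemma upd_agree n x y b j :
  (forall i, (i < n)%nat -> x i = y i) -> (j < S n)%nat -> upd x n b j = upd y n b j.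
Proof.
  intros H Hj. unfold upd. destruct (Nat.eqb_spec j n); [reflexivity|]. apply H. lia.
Qed.

Lemma dep_upd_self {T} n (u : point -> T) x : dep (S n) u -> G x -> u (upd x n (x n)) = u x.
Proof.
  intros Hu Hx. apply Hu; auto.
  - exact (G_upd x n (x n) Hx (Hx n)).
  - intros j _. unfold upd. destruct (Nat.eqb_spec j n); congruence.
Qed.

(** Maximising over the last coordinate lowers the level by one; at level 0 the function is
    constant. *)
Lemma dep_bounded n (u : point -> R) : dep n u -> exists b, forall x, G x -> u x <= b.
Proof.
  revert u. induction n as [|n IH]; intros u Hu.
  - exists (u zero). intros x Hx. right. apply Hu; auto using G_zero. intros; lia.
  - destruct (IH (fun x => rmax (m n) (fun b => u (upd x n b)))) as [b Hb].
    + intros x y Hx Hy Hxy. apply rmax_ext. intros b Hb.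
      apply Hu; auto using G_upd. intros; now apply upd_agree.
    + exists b. intros x Hx. eapply Rle_trans; [|now apply Hb].
      rewrite <- (dep_upd_self n u x Hu Hx).
      apply (rmax_ge (m n) (fun b => u (upd x n b))). apply Hx.
Qed.

Section Martingale.

Variable f : nat -> point -> Cx.
Hypothesis Hf : martingale m f.

Lemma f_dep n : dep n (f n).
Proof. destruct Hf as [H _]. exact (H n). Qed.

(** An F_n-measurable majorant of the modulus of f^(n+1), so that stopping can be decided one step
    ahead. *)
Definition cmax n x : R := rmax (m n) (fun b => Cmod (f (S n) (upd x n b))).

Lemma cmax_dep n : dep n (cmax n).
Proof.
  intros x y Hx Hy Hxy. apply rmax_ext. intros b Hb. f_equal.
  apply f_dep; auto using G_upd. intros; now apply upd_agree.
Qed.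

Lemma Cmod_next_le_cmax n x : G x -> Cmod (f (S n) x) <= cmax n x.
Proof.
  intros Hx. rewrite <- (dep_upd_self n (f (S n)) x (f_dep _) Hx).
  apply (rmax_ge (m n) (fun b => Cmod (f (S n) (upd x n b)))). apply Hx.
Qed.

Lemma Cmod_le_cmax n x : G x -> Cmod (f n x) <= cmax n x.
Proof.
  intros Hx. destruct Hf as [_ H]. rewrite (H n x Hx). pose proof (INR_m_ge2 n).
  assert (0 < / INR (m n)) by (apply Rinv_0_lt_compat; lra).
  rewrite Cmod_scale by lra.
  apply Rmult_le_reg_l with (INR (m n)); [lra|].
  rewrite <- Rmult_assoc, Rinv_r, Rmult_1_l by lra.
  eapply Rle_trans; [apply Cmod_sumC|]. rewrite <- sumR_const. apply sumR_le.
  intros b Hb. now apply (rmax_ge (m n) (fun b => Cmod (f (S n) (upd x n b)))).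
Qed.

(* The martingale started at level [n] and run for [r] steps, stopped at the first level
   one of whose successors has modulus above [s]. Stopping one step ahead keeps it bounded
   by [s]; it costs only a factor [K] in probability since the group is bounded. *)
Fixpoint stop s n r x : Cx :=
  match r with
  | O => f n x
  | S r' => if Rlt_dec s (cmax n x) then f n x else stop s (S n) r' x
  end.

Fixpoint stopped s n r x : R :=
  match r with
  | O => 0
  | S r' => if Rlt_dec s (cmax n x) then 1 else stopped s (S n) r' x
  end.

Fixpoint exceeds s n r x : R :=
  match r with
  | O => 0
  | S r' => if Rlt_dec s (Cmod (f (S n) x)) then 1 else exceeds s (S n) r' x
  end.

(** Optional stopping: the decision at level n is the same on the whole cell, where either the value
    is frozen or one martingale step leads to the induction hypothesis. *)
Lemma Cavg_stop s n r x : G x -> Cavg n r (stop s n r) x = f n x.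
Proof.
  revert n x. induction r as [|r IH]; intros n x Hx.
  - unfold Cavg; simpl. now destruct (f n x).
  - destruct (Rlt_dec s (cmax n x)) as [H|H].
    + rewrite (Cavg_ext_cell n (S r) _ (f n)); auto.
      * apply Cavg_dep_id; auto using f_dep.
      * intros y Hy Hyx. simpl. rewrite (cmax_dep n y x) by assumption.
        destruct (Rlt_dec s (cmax n x)); [reflexivity|contradiction].
    + rewrite (Cavg_ext_cell n (S r) _ (stop s (S n) r)); auto.
      * rewrite Cavg_S. destruct Hf as [_ Hmart]. rewrite (Hmart n x Hx). f_equal.
        apply sumC_ext. intros b Hb. auto using G_upd.
      * intros y Hy Hyx. simpl. rewrite (cmax_dep n y x) by assumption.
        destruct (Rlt_dec s (cmax n x)); [contradiction|reflexivity].
Qed.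

(** Past level n the threshold dominates all successors, hence also f^(n), which is their mean. The
    first alternative allows for a large f^(n), at which the process stops at once. *)
Lemma stop_bounded s n r x :
  0 <= s -> G x ->
  stop s n r x = f n x \/ (Cmod (f n x) <= s /\ Cmod (stop s n r x) <= s).
Proof.
  intros Hs Hx. revert n. induction r as [|r IH]; intros n; simpl; [now left|].
  destruct (Rlt_dec s (cmax n x)) as [H|H]; [now left|right].
  pose proof (Cmod_le_cmax n x Hx). pose proof (Cmod_next_le_cmax n x Hx).
  split; [lra|]. destruct (IH (S n)) as [-> | [_ H']]; lra.
Qed.

(** If the process stops at once the difference vanishes, so the size of f^(n) does not enter. *)
Lemma stop_close s n r x :
  0 <= s -> G x -> Cmod (Cadd (stop s n r x) (Cscale (-1) (f n x))) <= 2 * s.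
Proof.
  intros Hs Hx. destruct (stop_bounded s n r x Hs Hx) as [-> | [H1 H2]].
  - replace (Cadd (f n x) (Cscale (-1) (f n x))) with C0 by cx. rewrite Cmod_C0. lra.
  - eapply Rle_trans; [apply Cmod_add|].
    replace (Cmod (Cscale (-1) (f n x))) with (Cmod (f n x)); [lra|].
    unfold Cmod; simpl. f_equal. ring.
Qed.

(** The part of [A] on which threshold [s] stops at level n is F_n-measurable; there one process
    stays at f^(n) and the other has conditional mean f^(n), so the difference is an atom of height
    2 (2 s). On the rest of [A] the induction proceeds from level n + 1. *)
Lemma max_bound_stop_step N s r :
  0 <= s -> forall n (A : point -> R),
  (n + r = N)%nat -> dep n A -> (forall y, G y -> A y = 0 \/ A y = 1) ->
  max_bound N
    (fun y => Cscale (A y) (Cadd (stop (2 * s) n r y) (Cscale (-1) (stop s n r y))))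
    (C2 * sqrt (4 * s) * integral_lvl m N (fun y => A y * stopped s n r y)).
Proof.
  intros Hs. pose proof G_zero as Hz.
  induction r as [|r IH]; intros n A HN HdA HA.
  - apply max_bound_le with 0.
    + unfold integral_lvl.
      rewrite (avg_ext _ _ _ (fun _ => 0)) by (auto; intros; simpl; ring).
      rewrite avg_const. lra.
    + apply max_bound_zero. intros y _. simpl. cx.
  - set (h := fun y => if Rlt_dec s (cmax n y) then 1 else 0).
    assert (Hdh : dep n h).
    { intros x y Hx Hy Hxy. unfold h. now rewrite (cmax_dep n x y). }
    assert (Hh : forall y, h y = 0 \/ h y = 1).
    { intros y. unfold h. destruct (Rlt_dec s (cmax n y)); auto. }
    assert (B1 : max_bound N
      (fun y => Cscale (A y * h y) (Cadd (stop (2 * s) n (S r) y) (Cscale (-1) (f n y))))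
      (C2 * sqrt (4 * s) * integral_lvl m N (fun y => A y * h y))).
    { assert (Hd : dep n (fun y => A y * h y)).
      { intros x y Hx Hy Hxy. now rewrite (HdA x y), (Hdh x y). }
      apply (max_bound_atom N n); auto; try lia; try lra.
      - intros y Hy. destruct (HA y Hy) as [-> | ->], (Hh y) as [-> | ->]; lra.
      - intros y Hy.
        assert (H0 : 0 <= A y * h y)
          by (destruct (HA y Hy) as [-> | ->], (Hh y) as [-> | ->]; lra).
        rewrite Cmod_scale by assumption. rewrite Rmult_comm.
        apply Rmult_le_compat_r; [assumption|].
        pose proof (stop_close (2 * s) n (S r) y ltac:(lra) Hy). lra.
      - right. intros y Hy. replace (N - n)%nat with (S r) by lia.
        rewrite (Cavg_ext _ _ _ (fun y => Cmul (A y * h y, 0)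
          (Cadd (stop (2 * s) n (S r) y) (Cmul (-1, 0) (f n y))))) by (auto; intros; cx).
        rewrite (Cavg_mul_dep n _ (fun y => (A y * h y, 0))); auto.
        + rewrite Cavg_add, Cavg_mul, Cavg_stop, Cavg_dep_id by auto using f_dep. cx.
        + intros u v Hu Hv Huv. now rewrite (Hd u v). }
    (* Where [h] vanishes, [cmax] is at most s <= 2 s, so both processes continue. *)
    assert (B2 := IH (S n) (fun y => A y * (1 - h y)) ltac:(lia)).
    assert (Hd' : dep (S n) (fun y => A y * (1 - h y))).
    { apply (dep_mono n); [lia|].
      intros x y Hx Hy Hxy. now rewrite (HdA x y), (Hdh x y). }
    specialize (B2 Hd').
    assert (Hi : forall y, G y -> A y * (1 - h y) = 0 \/ A y * (1 - h y) = 1).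
    { intros y Hy. destruct (HA y Hy) as [-> | ->], (Hh y) as [-> | ->]; lra. }
    specialize (B2 Hi). pose proof (max_bound_add _ _ _ _ _ B1 B2) as B.
    eapply max_bound_le; [|eapply max_bound_ext; [|exact B]].
    + rewrite <- Rmult_plus_distr_l. right. f_equal.
      unfold integral_lvl. rewrite <- avg_plus. apply avg_ext; auto. intros y Hy.
      unfold h. simpl. destruct (Rlt_dec s (cmax n y)); ring.
    + intros y Hy. unfold h. simpl.
      destruct (Rlt_dec s (cmax n y)), (Rlt_dec (2 * s) (cmax n y)); try lra; cx.
Qed.

Lemma stopped_le_1 s n r x : stopped s n r x <= 1.
Proof.
  revert n. induction r as [|r IH]; intros n; simpl; [lra|].
  destruct (Rlt_dec s (cmax n x)); [lra|apply IH].
Qed.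

Lemma exceeds_nonneg s n r x : 0 <= exceeds s n r x.
Proof.
  revert n. induction r as [|r IH]; intros n; simpl; [lra|].
  destruct (Rlt_dec s (Cmod (f (S n) x))); [lra|apply IH].
Qed.

Lemma exceeds_le_1 s n r x : exceeds s n r x <= 1.
Proof.
  revert n. induction r as [|r IH]; intros n; simpl; [lra|].
  destruct (Rlt_dec s (Cmod (f (S n) x))); [lra|apply IH].
Qed.

(** When the process stops at level n, one of at most [K] equally likely successors exceeds [s], so
    the conditional probability of exceeding is at least 1 / K. *)
Lemma stopped_le_exceeds s n r x :
  0 <= s -> G x ->
  avg_from m n r (stopped s n r) x <= INR K * avg_from m n r (exceeds s n r) x.
Proof.
  intros Hs. revert n x. induction r as [|r IH]; intros n x Hx; [simpl; lra|].
  pose proof (INR_m_ge2 n) as Hm. pose proof (INR_m_leK n) as HmK.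
  assert (Hinv : 0 < / INR (m n)) by (apply Rinv_0_lt_compat; lra).
  destruct (Rlt_dec s (cmax n x)) as [H|H].
  - apply Rle_trans with 1.
    + rewrite <- (avg_const n (S r) 1 x). apply avg_le; auto. intros; apply stopped_le_1.
    + destruct (rmax_attained _ _ _ Hs H) as [b [Hb Hsb]]. cbn [avg_from].
      assert (H1 : 1 <= sumR (m n) (fun a => avg_from m (S n) r (exceeds s n (S r)) (upd x n a))).
      { apply Rle_trans with (avg_from m (S n) r (exceeds s n (S r)) (upd x n b)).
        - rewrite <- (avg_const (S n) r 1 (upd x n b)). right.
          apply avg_ext_cell; auto using G_upd. intros y Hy Hyx. simpl.
          rewrite (f_dep (S n) y (upd x n b)) by auto using G_upd.
          destruct (Rlt_dec s (Cmod (f (S n) (upd x n b)))); [reflexivity|contradiction].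
        - apply (sumR_term_le (m n) (fun a => avg_from m (S n) r (exceeds s n (S r)) (upd x n a)));
            auto. intros a Ha. apply avg_nonneg; auto using G_upd, exceeds_nonneg. }
      rewrite <- Rmult_assoc.
      apply Rle_trans with (INR (m n) * / INR (m n) * 1); [right; field; lra|].
      apply Rmult_le_compat; [rewrite Rinv_r; lra|lra| |assumption].
      apply Rmult_le_compat_r; lra.
  - rewrite (avg_ext_cell n (S r) _ (stopped s (S n) r)); auto.
    + cbn [avg_from].
      rewrite <- Rmult_assoc, (Rmult_comm (INR K)), Rmult_assoc.
      apply Rmult_le_compat_l; [lra|]. rewrite <- sumR_scal. apply sumR_le. intros b Hb.
      eapply Rle_trans; [apply IH; auto using G_upd|].
      pose proof K_ge2. apply Rmult_le_compat_l; [lra|].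
      apply avg_le; auto using G_upd. intros y Hy. simpl.
      destruct (Rlt_dec s (Cmod (f (S n) y))); [apply exceeds_le_1|lra].
    + intros y Hy Hyx. simpl. rewrite (cmax_dep n y x) by assumption.
      destruct (Rlt_dec s (cmax n x)); [contradiction|reflexivity].
Qed.

(** * Thresholds and the maximal function *)

Lemma maxH_ge N j x : (j <= N)%nat -> Cmod (f j x) <= maxH f N x.
Proof.
  induction N as [|N IH]; intros Hj.
  - replace j with 0%nat by lia. simpl. lra.
  - simpl. destruct (Nat.eq_dec j (S N)) as [->|]; [apply Rmax_r|].
    eapply Rle_trans; [apply IH; lia|apply Rmax_l].
Qed.

Lemma exceeds_le_maxH N s n r x :
  (n + r <= N)%nat -> exceeds s n r x <= if Rlt_dec s (maxH f N x) then 1 else 0.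
Proof.
  revert n. induction r as [|r IH]; intros n HN; simpl.
  - destruct (Rlt_dec s (maxH f N x)); lra.
  - destruct (Rlt_dec s (Cmod (f (S n) x))); [|apply IH; lia].
    pose proof (maxH_ge N (S n) x ltac:(lia)). destruct (Rlt_dec s (maxH f N x)); lra.
Qed.

Lemma maxH_dep N : dep N (maxH f N).
Proof.
  induction N as [|N IH]; intros x y Hx Hy Hxy; simpl.
  - now rewrite (f_dep 0 x y).
  - rewrite (IH x y), (f_dep (S N) x y); auto.
Qed.

Lemma stop_large s n r x :
  0 <= s -> G x -> (forall j y, (j <= n + r)%nat -> G y -> Cmod (f j y) <= s) ->
  stop s n r x = f (n + r)%nat x.
Proof.
  intros Hs Hx. revert n. induction r as [|r IH]; intros n H; simpl.
  - now rewrite Nat.add_0_r.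
  - destruct (Rlt_dec s (cmax n x)) as [Hc|Hc].
    + exfalso. destruct (rmax_attained _ _ _ Hs Hc) as [b [Hb Hsb]].
      specialize (H (S n) (upd x n b) ltac:(lia) ltac:(auto using G_upd)). lra.
    + rewrite Nat.add_succ_r. apply (IH (S n)). intros j y Hj. apply H. lia.
Qed.

(** The roots grow geometrically with ratio 2^{1/2} > 4/3, so those before the largest eps 2^k below
    X add up to at most 3 times its root. The bound is uniform in [L]. *)
Lemma threshold_sum_le eps X L :
  0 < eps -> 0 <= X ->
  sumR L (fun k => sqrt (eps * 2 ^ k) * (if Rlt_dec (eps * 2 ^ k) X then 1 else 0))
  <= 4 * sqrt X.
Proof.
  intros He HX.
  assert (Hp : forall k, 0 < eps * 2 ^ k)
    by (intros; apply Rmult_lt_0_compat; [assumption|apply pow_lt; lra]).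
  assert (Hgeo : forall k, sumR k (fun k => sqrt (eps * 2 ^ k)) <= 3 * sqrt (eps * 2 ^ k)).
  { induction k as [|k IH].
    - simpl sumR. pose proof (sqrt_pos (eps * 2 ^ 0)). lra.
    - cbn [sumR]. pose proof (sqrt_pos (eps * 2 ^ k)). pose proof (sqrt_pos (eps * 2 ^ S k)).
      assert (4 * sqrt (eps * 2 ^ k) <= 3 * sqrt (eps * 2 ^ S k)); [|lra].
      pose proof (Hp k). pose proof (Hp (S k)).
      apply Rsqr_incr_0_var; [|lra]. rewrite !Rsqr_mult, !Rsqr_sqrt by lra.
      simpl pow. unfold Rsqr. nra. }
  induction L as [|L IH]; cbn [sumR].
  - pose proof (sqrt_pos X). lra.
  - destruct (Rlt_dec (eps * 2 ^ L) X) as [H|H]; [|lra].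
    apply Rle_trans with (4 * sqrt (eps * 2 ^ L)).
    + specialize (Hgeo L).
      assert (sumR L (fun k => sqrt (eps * 2 ^ k) * (if Rlt_dec (eps * 2 ^ k) X then 1 else 0))
              <= sumR L (fun k => sqrt (eps * 2 ^ k))); [|lra].
      apply sumR_le. intros k _. pose proof (sqrt_pos (eps * 2 ^ k)).
      destruct (Rlt_dec (eps * 2 ^ k) X); lra.
    + apply Rmult_le_compat_l; [lra|]. apply sqrt_le_1_alt. lra.
Qed.

Lemma C2_nonneg : 0 <= C2.
Proof.
  pose proof ln_lt_2. pose proof K_ge2.
  apply Rmult_le_pos; [apply sqrt_pos|]. left. apply Rdiv_lt_0_compat; lra.
Qed.

(** Telescoping over thresholds eps 2^k. The martingale stopped at [eps] is an atom of level 0 and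
    height |f^(0)| + 2 eps. In 8 K, a 2 is the root of the 4 in the atom height, [K] compares
    stopping with exceeding, and 4 is from the sum over thresholds. *)
Lemma max_bound_martingale N eps :
  0 < eps ->
  max_bound N (f N)
    (C2 * sqrt (Cmod (f 0%nat zero) + 2 * eps)
     + C2 * (8 * INR K) * integral_lvl m N (fun x => sqrt (maxH f N x))).
Proof.
  intros He. pose proof G_zero as Hz. pose proof C2_nonneg as HC2. pose proof K_ge2 as HK2.
  assert (Hp : forall k, 0 < eps * 2 ^ k)
    by (intros; apply Rmult_lt_0_compat; [assumption|apply pow_lt; lra]).
  assert (HL : forall L, max_bound N (stop (eps * 2 ^ L) 0 N)
    (C2 * sqrt (Cmod (f 0%nat zero) + 2 * eps)
     + sumR L (fun k => C2 * sqrt (4 * (eps * 2 ^ k))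
                        * integral_lvl m N (stopped (eps * 2 ^ k) 0 N)))).
  { induction L as [|L IH].
    - apply max_bound_le
        with (C2 * sqrt (Cmod (f 0%nat zero) + 2 * eps) * integral_lvl m N (fun _ => 1)).
      + unfold integral_lvl. rewrite avg_const. simpl. lra.
      + pose proof (Cmod_ge0 (f 0%nat zero)).
        apply (max_bound_atom N 0); auto; try lia; try lra.
        * intros x y _ _ _. reflexivity.
        * intros y Hy. simpl pow. rewrite !Rmult_1_r.
          replace (stop eps 0 N y)
            with (Cadd (f 0%nat y) (Cadd (stop eps 0 N y) (Cscale (-1) (f 0%nat y)))) by cx.
          eapply Rle_trans; [apply Cmod_add|].
          rewrite (f_dep 0 y zero) at 1 by (auto; intros; lia).
          pose proof (stop_close eps 0 N y ltac:(lra) Hy). lra.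
    - pose proof (max_bound_stop_step N (eps * 2 ^ L) N ltac:(pose proof (Hp L); lra) 0
        (fun _ => 1) eq_refl ltac:(intros x y _ _ _; reflexivity) ltac:(auto)) as B.
      cbn [sumR]. rewrite <- Rplus_assoc.
      eapply max_bound_le; [|eapply max_bound_ext; [|exact (max_bound_add _ _ _ _ _ IH B)]].
      + apply Rplus_le_compat_l. right. f_equal. unfold integral_lvl.
        apply avg_ext; auto. intros; ring.
      + intros y _. replace (eps * 2 ^ S L) with (2 * (eps * 2 ^ L)) by (simpl; ring). cx. }
  (* At the finite level [N] the maximal function is bounded, so for large [L] the process stopped
     at eps 2^L is f^(N) itself; Bernoulli's inequality 2^L >= 1 + L makes an [L] above b / eps
     sufficient. *)
  destruct (dep_bounded N _ (maxH_dep N)) as [b Hb].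
  destruct (INR_unbounded (b / eps)) as [L HbL].
  assert (HbL' : b <= eps * 2 ^ L).
  { pose proof (poly L 1 ltac:(lra)) as Hpow. replace (1 + 1) with 2 in Hpow by ring.
    assert (b < eps * INR L); [|nra].
    apply Rmult_lt_reg_r with (/ eps); [now apply Rinv_0_lt_compat|].
    replace (eps * INR L * / eps) with (INR L) by (field; lra). exact HbL. }
  eapply max_bound_le; [|eapply max_bound_ext; [|exact (HL L)]].
  - apply Rplus_le_compat_l.
    apply Rle_trans with (C2 * (2 * INR K) * integral_lvl m N (fun x => 4 * sqrt (maxH f N x))).
    2:{ unfold integral_lvl. rewrite avg_scal. right. ring. }
    apply Rle_trans with (C2 * (2 * INR K) * integral_lvl m N (fun x =>
      sumR L (fun k => sqrt (eps * 2 ^ k) * (if Rlt_dec (eps * 2 ^ k) (maxH f N x) then 1 else 0)))).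
    + unfold integral_lvl. rewrite (avg_sumR 0 N L (fun k x => sqrt (eps * 2 ^ k) * (if Rlt_dec (eps * 2 ^ k) (maxH f N x) then 1 else 0))).
      rewrite <- sumR_scal. apply sumR_le. intros k _. rewrite avg_scal.
      pose proof (Hp k). pose proof (sqrt_pos (eps * 2 ^ k)) as Hsq.
      rewrite sqrt_mult by lra. replace (sqrt 4) with 2.
      2:{ replace 4 with (2 * 2) by ring. rewrite sqrt_square; lra. }
      pose proof (stopped_le_exceeds (eps * 2 ^ k) 0 N zero ltac:(lra) Hz) as Hse.
      assert (Hex : avg_from m 0 N (exceeds (eps * 2 ^ k) 0 N) zero
        <= avg_from m 0 N (fun x => if Rlt_dec (eps * 2 ^ k) (maxH f N x) then 1 else 0) zero).
      { apply avg_le; auto. intros x Hx. now apply exceeds_le_maxH. }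
      set (P1 := avg_from m 0 N (stopped _ _ _) _) in *.
      set (P2 := avg_from m 0 N (exceeds _ _ _) _) in *.
      set (P3 := avg_from m 0 N (fun x => if Rlt_dec _ _ then 1 else 0) _) in *.
      assert (P1 <= INR K * P3) by nra.
      replace (C2 * (2 * INR K) * (sqrt (eps * 2 ^ k) * P3))
        with (C2 * (2 * sqrt (eps * 2 ^ k)) * (INR K * P3)) by ring.
      apply Rmult_le_compat_l; [|assumption]. apply Rmult_le_pos; lra.
    + apply Rmult_le_compat_l; [apply Rmult_le_pos; lra|].
      apply avg_le; auto. intros x Hx. apply threshold_sum_le; auto.
      eapply Rle_trans; [apply (Cmod_ge0 (f 0%nat x))|]. apply maxH_ge. lia.
  - intros y Hy. apply (stop_large _ 0 N); auto.
    + pose proof (Hp L). lra.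
    + intros j x Hj Hx. pose proof (maxH_ge N j x Hj). specialize (Hb x Hx). lra.
Qed.

Lemma maxSig_integral_le N w :
  max_bound N (f N) w -> integral_lvl m N (fun x => sqrt (maxSig m f N x)) <= w.
Proof.
  intros [W [HW0 [HW HWi]]]. eapply Rle_trans; [|exact HWi].
  apply avg_le; [apply G_zero|]. intros x Hx.
  assert (H : forall n, (n <= N)%nat -> sqrt (maxSig m f n x) <= W x).
  { induction n as [|n IH]; intros Hn; simpl; [rewrite sqrt_0; auto|].
    apply Rmax_case; [apply IH; lia|].
    rewrite (fejer_Sig f (S n) N) by assumption. apply (HW x (S n) Hx). lia. }
  auto.
Qed.

(** The free threshold [eps] is taken to be [B]. As f^(0) is constant and dominated by the maximal
    function, |f^(0)| <= B, so the starting atom has height at most 3 B; hence the sqrt 3. *)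
Lemma Snorm_le N B :
  0 < B -> Hnorm_approx m f N <= B ->
  Snorm_approx m f N <= (C2 * (sqrt 3 + 8 * INR K)) ^ 2 * B.
Proof.
  intros HB HN. unfold Hnorm_approx in HN. unfold Snorm_approx.
  pose proof G_zero as Hz. pose proof C2_nonneg. pose proof K_ge2.
  pose proof (maxSig_integral_le N _ (max_bound_martingale N B HB)) as HS.
  set (h := integral_lvl m N (fun x => sqrt (maxH f N x))) in *.
  set (u := integral_lvl m N (fun x => sqrt (maxSig m f N x))) in *.
  assert (Hu : 0 <= u) by (apply avg_nonneg; auto; intros; apply sqrt_pos).
  assert (Hf0 : sqrt (Cmod (f 0%nat zero)) <= h).
  { unfold h, integral_lvl. rewrite <- (avg_const 0 N (sqrt (Cmod (f 0%nat zero))) zero).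
    apply avg_le; auto. intros x Hx. apply sqrt_le_1_alt.
    rewrite (f_dep 0 zero x) by (auto; intros; lia). apply maxH_ge. lia. }
  pose proof (sqrt_pos (Cmod (f 0%nat zero))).
  pose proof (sqrt_sqrt _ (Cmod_ge0 (f 0%nat zero))).
  assert (HhB : h <= sqrt B).
  { rewrite <- (sqrt_pow2 h) by lra. now apply sqrt_le_1_alt. }
  assert (HfB : Cmod (f 0%nat zero) <= B) by nra.
  assert (H3 : sqrt (Cmod (f 0%nat zero) + 2 * B) <= sqrt 3 * sqrt B).
  { rewrite <- sqrt_mult by lra. apply sqrt_le_1_alt. lra. }
  assert (Hfin : u <= C2 * (sqrt 3 + 8 * INR K) * sqrt B).
  { eapply Rle_trans; [exact HS|].
    replace (C2 * (sqrt 3 + 8 * INR K) * sqrt B)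
      with (C2 * (sqrt 3 * sqrt B) + C2 * (8 * INR K) * sqrt B) by ring.
    apply Rplus_le_compat; apply Rmult_le_compat_l; try assumption.
    apply Rmult_le_pos; lra. }
  rewrite <- (pow2_sqrt B) at 1 by lra. rewrite <- Rpow_mult_distr.
  apply pow_incr. lra.
Qed.

End Martingale.

End Vilenkin.

Theorem theorem1 (m : nat -> nat)
  (Hm2 : forall k, (2 <= m k)%nat)
  (Hbdd : exists K : nat, forall k, (m k <= K)%nat) :
  exists c : R,
    forall f : nat -> point -> Cx, martingale m f ->
    forall B : R, (forall N, Hnorm_approx m f N <= B) ->
    forall N, Snorm_approx m f N <= c * B.
Proof.
  destruct Hbdd as [K HK].
  set (c := (C2 K * (sqrt 3 + 8 * INR K)) ^ 2).
  assert (Hc : 0 <= c) by apply pow2_ge_0.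
  exists c. intros f Hf B HB N.
  assert (HB0 : 0 <= B).
  { eapply Rle_trans; [|apply (HB N)]. apply pow2_ge_0. }
  destruct HB0 as [HB0 | <-].
  - now apply (Snorm_le m K Hm2 HK f Hf).
  (* Thresholds must be positive, so for [B] = 0 the bound is applied with e / (c + 1) and e is
     arbitrary; adding 1 keeps the denominator positive. *)
  - apply le_epsilon. intros e He.
    assert (He' : 0 < e / (c + 1)) by (apply Rdiv_lt_0_compat; lra).
    eapply Rle_trans; [apply (Snorm_le m K Hm2 HK f Hf N (e / (c + 1)) He')|].
    + specialize (HB N). lra.
    + fold c. rewrite Rmult_0_r, Rplus_0_l.
      replace e with ((c + 1) * (e / (c + 1))) at 2 by (field; lra).
      apply Rmult_le_compat_r; lra.
Qed.
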